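(* Let $T$ be the complete theory of an o-minimal expansion of the ordered additive group of the real numbers $(\mathbb{R},<,+)$. If $(\mathbb{M},\mathbb{P})$ is the monster model of the theory $T_P$ of lovely pairs of $T$, then $o(\mathbb{P})\neq e(\mathbb{P})$.
   Context: Conventions. $T$ is a complete first-order theory in a language $L$ with an infinite model. Fix a strongly inaccessible cardinal $\lambda>|L|$; the monster model of a complete theory is its saturated model of cardinality $\lambda$ (unique up to isomorphism), and ''small'' means of cardinality $<\lambda$. $\mathbb{M}$ is the monster model of $T$. For $\mathbb{D}\subseteq\mathbb{M}$, $(\mathbb{M},\mathbb{D})$ is the expansion of $\mathbb{M}$ by a new predicate interpreted as $\mathbb{D}$, and $o(\mathbb{D})=\{\mathbb{D}'\subseteq\mathbb{M}\mid(\mathbb{M},\mathbb{D})\cong(\mathbb{M},\mathbb{D}')\}=\{f(\mathbb{D})\mid f\in\mathrm{Aut}(\mathbb{M})\}$, $e(\mathbb{D})=\{\mathbb{D}'\subseteq\mathbb{M}\mid(\mathbb{M},\mathbb{D})\equiv(\mathbb{M},\mathbb{D}')\}$. O-minimal theories are geometric: $\mathrm{acl}$ satisfies exchange in models of $T$ and $T$ eliminates the quantifier $\exists^\infty$. Lovely pairs. Let $T$ be geometric and $L_P=L\cup\{P\}$ with $P$ a new unary predicate. An $L_P$-structure $(M,P(M))$ with $M\models T$ is a lovely pair of $T$ if $P(M)\preceq M$ in $L$ and: (Coheir/density) for every finite $A\subseteq M$, every non-algebraic $L$-type $q(x)\in S_1(A)$ has a realization in $P(M)$; (Extension) for every finite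 $A\subseteq M$, every non-algebraic $L$-type $q(x)\in S_1(A)$ has a realization $a\in M$ with $a\notin\mathrm{acl}(A\cup P(M))$. Here $\mathrm{acl}$ is in the sense of $L$. All lovely pairs of $T$ are elementarily equivalent; their common complete theory is denoted $T_P$ (the theory of lovely pairs of $T$). It is axiomatized by $T$ together with: $P$ is an $L$-elementary substructure; if $\varphi(\bar a,x)$ ($\varphi\in L$) has infinitely many solutions, it has a solution in $P$; if $\varphi(\bar a,x)$ has infinitely many solutions and, for every $\bar y$, $\psi(\bar a,\bar y,x)$ has fewer than $k$ solutions, then some solution $x$ of $\varphi(\bar a,x)$ satisfies $\neg\psi(\bar a,\bar y,x)$ for all $\bar y$ from $P$ ($\varphi,\psi\in L$). Every $\omega$-saturated model of $T_P$ is a lovely pair. The $L$-reduct of the monster model of $T_P$ is identified with $\mathbb{M}$, and $\mathbb{P}=P(\mathbb{M})$. *)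

(* Defs.v *)
From mathcomp Require Import all_boot all_order all_algebra.
From mathcomp Require Import all_classical all_reals.
Set Implicit Arguments.
Unset Strict Implicit.
Unset Printing Implicit Defensive.
Import Order.TTheory GRing.Theory Num.Theory.
Local Open Scope classical_set_scope.
Local Open Scope card_scope.

(* Under choice, |A| < |B| iff B does not inject into A. *)
Definition card_lt (T U : Type) (A : set T) (B : set U) : Prop :=
  ~~ (B #<= A).

Record strongly_inaccessible (Lam : Type) : Prop := StronglyInaccessible {
  inacc_uncountable : ~~ countable [set: Lam];
  inacc_regular : forall (I : set Lam) (F : Lam -> set Lam),
    card_lt I [set: Lam] ->
    (forall i, I i -> card_lt (F i) [set: Lam]) ->
    card_lt (\bigcup_(i in I) F i) [set: Lam];
  inacc_strong_limit : forall X : set Lam,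
    card_lt X [set: Lam] ->
    card_lt [set Y : set Lam | Y `<=` X] [set: Lam]
}.

Record language : Type := Language {
  fsym : Type;
  farity : fsym -> nat;
  rsym : Type;
  rarity : rsym -> nat
}.

Definition lang_sum (L1 L2 : language) : language := {|
  fsym := fsym L1 + fsym L2;
  farity := fun f => match f with inl f => farity f | inr f => farity f end;
  rsym := rsym L1 + rsym L2;
  rarity := fun r => match r with inl r => rarity r | inr r => rarity r end
|}.

(* With an uncountable strict upper bound, bounding the number of symbols is
   the same as bounding the number of formulas. *)
Definition lang_card_lt (L : language) (Lam : Type) : Prop :=
  card_lt [set: (fsym L + rsym L)%type] [set: Lam].

Inductive term (L : language) (V : Type) : Type :=
| tvar (x : V)
| tapp (f : fsym L) (t : 'I_(farity f) -> term L V).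

(* Free variables are indexed by [V]; under a quantifier the bound variable is
   [None].  Parameters are free variables that are then evaluated. *)
Inductive formula (L : language) (V : Type) : Type :=
| fbot
| feq (s t : term L V)
| frel (r : rsym L) (t : 'I_(rarity r) -> term L V)
| fimp (phi psi : formula L V)
| fall (phi : formula L (option V)).

Definition fneg (L : language) (V : Type) (phi : formula L V) : formula L V :=
  fimp phi (fbot L V).

Record structure (L : language) (M : Type) : Type := Structure {
  finterp : forall f : fsym L, ('I_(farity f) -> M) -> M;
  rinterp : forall r : rsym L, ('I_(rarity r) -> M) -> Prop
}.

Definition struct_sum (L1 L2 : language) (M : Type)
    (S1 : structure L1 M) (S2 : structure L2 M) :
    structure (lang_sum L1 L2) M := {|
  finterp := fun f : fsym (lang_sum L1 L2) =>
    match f return ('I_(@farity (lang_sum L1 L2) f) -> M) -> M with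
    | inl f => finterp S1 (f := f)
    | inr f => finterp S2 (f := f)
    end;
  rinterp := fun r : rsym (lang_sum L1 L2) =>
    match r return ('I_(@rarity (lang_sum L1 L2) r) -> M) -> Prop with
    | inl r => rinterp S1 (r := r)
    | inr r => rinterp S2 (r := r)
    end
|}.

Fixpoint eval (L : language) (M : Type) (S : structure L M) (V : Type)
    (v : V -> M) (t : term L V) : M :=
  match t with
  | tvar x => v x
  | tapp f ts => finterp S (fun i => eval S v (ts i))
  end.

Fixpoint sat (L : language) (M : Type) (S : structure L M) (V : Type)
    (phi : formula L V) : (V -> M) -> Prop :=
  match phi with
  | fbot => fun=> False
  | feq s t => fun v => eval S v s = eval S v t
  | frel r ts => fun v => rinterp S (fun i => eval S v (ts i))
  | fimp phi psi => fun v => sat S phi v -> sat S psi v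
  | fall phi => fun v => forall x : M, sat S phi (oapp v x)
  end.

Definition sentence (L : language) : Type := formula L void.

Definition theory_of (L : language) (M : Type) (S : structure L M) :
    set (sentence L) :=
  [set phi | sat S phi (of_void M)].

Definition models (L : language) (M : Type) (S : structure L M)
    (T : set (sentence L)) : Prop :=
  T `<=` theory_of S.

Definition elementarily_equivalent (L : language) (M N : Type)
    (S : structure L M) (S' : structure L N) : Prop :=
  theory_of S = theory_of S'.

Definition is_isomorphism (L : language) (M N : Type)
    (S : structure L M) (S' : structure L N) (f : M -> N) : Prop :=
  [/\ bijective f,
      forall (g : fsym L) (v : 'I_(farity g) -> M),
        f (finterp S v) = finterp S' (f \o v) &
      forall (r : rsym L) (v : 'I_(rarity r) -> M),
        rinterp S v <-> rinterp S' (f \o v)].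

Definition isomorphic (L : language) (M N : Type)
    (S : structure L M) (S' : structure L N) : Prop :=
  exists f : M -> N, is_isomorphism S S' f.

Definition elementary_embedding (L : language) (M N : Type)
    (S : structure L M) (S' : structure L N) (f : M -> N) : Prop :=
  forall (V : Type) (phi : formula L V) (v : V -> M),
    sat S phi v <-> sat S' phi (f \o v).

(* The structure on [A] is unique when it exists: it is the induced one. *)
Definition elementary_substructure (L : language) (M : Type)
    (S : structure L M) (A : set M) : Prop :=
  exists S' : structure L A,
    elementary_embedding S' S (fun a : A => \val a).

(* Formulas over [A] in one variable: [Some a] is the parameter [a] and [None]
   is the variable. *)
Definition formula1 (L : language) (M : Type) (A : set M) : Type :=
  formula L (option A).

Definition solutions (L : language) (M : Type) (S : structure L M)
    (A : set M) (phi : formula1 L A) : set M :=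
  [set x | sat S phi (oapp (fun a : A => \val a) x)].

Definition definable_over (L : language) (M : Type) (S : structure L M)
    (A D : set M) : Prop :=
  exists phi : formula1 L A, D = solutions S phi.

Definition acl (L : language) (M : Type) (S : structure L M)
    (A : set M) : set M :=
  [set x | exists phi : formula1 L A,
     finite_set (solutions S phi) /\ solutions S phi x].

Definition realizes (L : language) (M : Type) (S : structure L M)
    (A : set M) (q : set (formula1 L A)) (x : M) : Prop :=
  forall phi, q phi -> solutions S phi x.

(* [q] belongs to $S_1(A)$; consistency with the theory of the structure with
   names for [A] is finite satisfiability in the structure. *)
Definition complete_type (L : language) (M : Type) (S : structure L M)
    (A : set M) (q : set (formula1 L A)) : Prop :=
  (forall q0 : set (formula1 L A),
     q0 `<=` q -> finite_set q0 -> exists x, realizes S q0 x) /\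
  (forall phi, q phi \/ q (fneg phi)).

Definition nonalgebraic_type (L : language) (M : Type) (S : structure L M)
    (A : set M) (q : set (formula1 L A)) : Prop :=
  forall phi, q phi -> infinite_set (solutions S phi).

Definition saturated (L : language) (M : Type) (S : structure L M) : Prop :=
  forall (A : set M) (q : set (formula1 L A)),
    card_lt A [set: M] -> complete_type S q -> exists x, realizes S q x.

Definition monster_model (L : language) (Lam : Type) (T : set (sentence L))
    (M : Type) (S : structure L M) : Prop :=
  [/\ models S T, saturated S & [set: M] #= [set: Lam]].

Definition pred_lang : language := {|
  fsym := void;
  farity := fun=> 0%N;
  rsym := unit;
  rarity := fun=> 1%N
|}.

Definition pred_struct (M : Type) (D : set M) : structure pred_lang M := {|
  finterp := fun f : fsym pred_lang =>
    match f return ('I_(@farity pred_lang f) -> M) -> M with end;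
  rinterp := fun (_ : rsym pred_lang) (v : 'I_1 -> M) => D (v ord0)
|}.

Definition pair_lang (L : language) : language := lang_sum L pred_lang.

Definition expand_pred (L : language) (M : Type) (S : structure L M)
    (D : set M) : structure (pair_lang L) M :=
  struct_sum S (pred_struct D).

Definition o_class (L : language) (M : Type) (S : structure L M) (D : set M) :
    set (set M) :=
  [set D' | isomorphic (expand_pred S D) (expand_pred S D')].

Definition e_class (L : language) (M : Type) (S : structure L M) (D : set M) :
    set (set M) :=
  [set D' | elementarily_equivalent (expand_pred S D) (expand_pred S D')].

Lemma o_classE (L : language) (M : Type) (S : structure L M) (D : set M) :
  o_class S D = [set f @` D | f in [set f | is_isomorphism S S f]].
Proof.
apply/seteqP; split => [D' [f [bf ff fr]]|_ [f [bf ff fr] <-]] /=.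
- exists f; first by split=> // g v; [exact: (ff (inl g))|exact: (fr (inl g))].
  case: (bf) => h fK hK; apply/seteqP; split => [_ [x Dx <-]|y D'y].
    by have /= [+ _] := fr (inr tt) (fun=> x); exact.
  exists (h y) => //; have /= [_] := fr (inr tt) (fun=> h y).
  by apply; rewrite hK.
- exists f; split=> // [[g|[]] v|[r|[]] v] /=; [exact: ff|exact: fr|].
  split=> [Dv|[x Dx /(bij_inj bf) <- //]].
  by exists (v ord0).
Qed.

Record lovely_pair (L : language) (T : set (sentence L)) (M : Type)
    (S : structure L M) (P : set M) : Prop := LovelyPair {
  lovely_models : models S T;
  lovely_elementary : elementary_substructure S P;
  lovely_coheir : forall (A : set M) (q : set (formula1 L A)),
    finite_set A -> complete_type S q -> nonalgebraic_type S q ->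
    exists a, P a /\ realizes S q a;
  lovely_extension : forall (A : set M) (q : set (formula1 L A)),
    finite_set A -> complete_type S q -> nonalgebraic_type S q ->
    exists a, ~ acl S (A `|` P) a /\ realizes S q a
}.

(* Common to all lovely pairs of $T$, hence complete as these are elementarily
   equivalent. *)
Definition lovely_theory (L : language) (T : set (sentence L)) :
    set (sentence (pair_lang L)) :=
  [set phi | forall (M : Type) (S : structure L M) (P : set M),
     lovely_pair T S P -> theory_of (expand_pred S P) phi].

Definition ogroup_lang : language := {|
  fsym := unit;
  farity := fun=> 2%N;
  rsym := unit;
  rarity := fun=> 2%N
|}.

Definition ogroup_struct (R : realType) : structure ogroup_lang R := {|
  finterp := fun (_ : fsym ogroup_lang) (v : 'I_2 -> R) =>
    (v ord0 + v ord_max)%R;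
  rinterp := fun (_ : rsym ogroup_lang) (v : 'I_2 -> R) =>
    (v ord0 < v ord_max)%R
|}.

(* Every definable subset, with parameters, is a finite union of intervals;
   points are the intervals `[a, a]. *)
Definition o_minimal (L : language) (R : realType) (S : structure L R) : Prop :=
  forall D : set R, definable_over S [set: R] D ->
    exists s : seq (interval R), D = [set x | exists2 i, i \in s & x \in i].

(* Main.v *)
Require Import Defs.
From mathcomp Require Import all_boot all_order all_algebra.
From mathcomp Require Import all_classical all_reals.
From mathcomp Require Import lra.

(** The closure operator [dcl] is a pregeometry on [M], because [M] is elementarily
    equivalent to an o-minimal expansion of the real line and o-minimality passes to [M]
    (uniform finiteness).  Choose a sequence [c] with each [c n] outside
    [dcl (P, c 0, ..., c n.-1)] and, by Zorn, a maximal [D] containing [P] for which this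
    still holds.  Maximality makes [D] [dcl]-closed and, by exchange, [D] together with the
    [c n] generates [M], whereas by saturation no countable set generates [M] over [P]; so
    [(M, D)] and [(M, P)] are not isomorphic.  On the other hand [P] and [D] are both
    dense, realize all nonalgebraic types over finite sets and have infinite codimension,
    so a back-and-forth argument shows that [(M, D)] and [(M, P)] are elementarily
    equivalent; the group operation is used to translate an element independent from [D]
    into a given interval.

    Uniform finiteness is proved by taking, with Zorn, a maximal parameter set [A] of [M]
    over which definable sets without interior are finite.  Definable choice makes [A]
    an elementary substructure, and it is o-minimal, so that uniform finiteness for
    one-parameter families in [A] allows one more parameter. *)

Set Implicit Arguments.
Unset Strict Implicit.
Unset Printing Implicit Defensive.
Import Order.TTheory GRing.Theory Num.Theory.
Local Open Scope classical_set_scope.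
Local Open Scope card_scope.

(** * Renaming, finite support and universal closure *)

(** The hypothesis speaks of the real line only, while exchange and back-and-forth take place in
    [M]. Uniform finiteness for families with many parameters would call for an induction on
    dimension; adding parameters one at a time leaves plane families, where it is enough that a
    definable function stays close to a constant on a subinterval. The maximal parameter set
    contains a realization of the type of the real number 1: definable choice needs a positive
    parameter, and over no parameters 0 may be the only definable point.

    The pair [(M, D)] is not saturated, since [D] has countable codimension. The back-and-forth
    therefore relies on saturation of the reduct over finite sets and on the properties collected in
    [rich]. For [D], density and realization of types are inherited from [P], closure comes from
    maximality, and infinite codimension from the sequence [c]. *)

Lemma finite_set_rect_prop (T : Type) (Q : set T -> Prop) :
  Q set0 -> (forall x B, finite_set B -> Q B -> Q (x |` B)) ->
  forall B, finite_set B -> Q B.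
Proof.
move=> Q0 QU B /(@finite_seqP {classic T}) [s ->].
elim: s => [|x s IHs].
  by rewrite [X in Q X](_ : _ = set0)//; apply/seteqP; split.
rewrite [X in Q X](_ : _ = (x : T) |` [set` s]).
  by apply: QU => //; apply/(@finite_seqP {classic T}); exists s.
apply/seteqP; split=> y /=; rewrite inE; first by case/predU1P; [left|right].
by move=> [->|->]; rewrite ?eqxx ?orbT.
Qed.

(** Finite character, for the Zorn arguments about definability over a union; the first alternative
    covers the empty chain. *)
Lemma finite_sub_chain (T : Type) (A B : set T) (F : set (set T)) :
  total_on F subset -> finite_set B -> B `<=` A `|` \bigcup_(X in F) X ->
  B `<=` A \/ exists X, F X /\ B `<=` A `|` X.
Proof.
move=> Ftot Bf; elim/finite_set_rect_prop : Bf => [_|b {}B _ IH BF]; first by left.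
have HB : B `<=` A \/ exists X, F X /\ B `<=` A `|` X.
  by apply: IH => c Bc; apply: BF; right.
have [Ab|[Y FY Yb]] := BF b (or_introl erefl).
  case: HB => [BA|[X [FX BX]]]; [left|right].
    by move=> c [->|/BA].
  by exists X; split=> // c [->|/BX//]; left.
right; case: HB => [BA|[X [FX BX]]].
  by exists Y; split=> // c [->|/BA]; [right|left].
have [XY|YX] := Ftot _ _ FX FY.
  by exists Y; split=> // c [->|/BX[|/XY]]; [right|left|right].
by exists X; split=> // c [->|/BX//]; right; exact: YX.
Qed.

Section Syntax.
Variable L : language.

Fixpoint trename (V W : Type) (h : V -> W) (t : term L V) : term L W :=
  match t with
  | tvar x => tvar L (h x)
  | tapp f ts => tapp (fun i => trename h (ts i))
  end.

Fixpoint frename (V W : Type) (h : V -> W) (phi : formula L V) : formula L W :=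
  match phi with
  | fbot => fbot L W
  | feq s t => feq (trename h s) (trename h t)
  | Defs.frel r ts => Defs.frel (fun i => trename h (ts i))
  | fimp phi psi => fimp (frename h phi) (frename h psi)
  | fall phi => fall (frename (omap h) phi)
  end.

Definition fand V (phi psi : formula L V) := fneg (fimp phi (fneg psi)).
Definition for_ V (phi psi : formula L V) := fimp (fneg phi) psi.
Definition fex V (phi : formula L (option V)) := fneg (fall (fneg phi)).

Variables (M : Type) (S : structure L M).

Lemma eval_rename V W (h : V -> W) (t : term L V) v :
  eval S v (trename h t) = eval S (v \o h) t.
Proof. by elim: t => //= f ts IH; congr finterp; apply/funext => i. Qed.

Lemma oapp_omap V W (h : V -> W) (v : W -> M) x :
  oapp v x \o omap h = oapp (v \o h) x.
Proof. by apply/funext => -[]. Qed.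

Lemma sat_rename V (phi : formula L V) W (h : V -> W) v :
  sat S (frename h phi) v = sat S phi (v \o h).
Proof.
elim: phi W h v => //= [{}V s t|{}V r ts|{}V phi IH1 psi IH2|{}V phi IH] W h v.
- by rewrite !eval_rename.
- by congr rinterp; apply/funext => i; rewrite eval_rename.
- by rewrite IH1 IH2.
- rewrite propeqE; split=> H x.
  + by rewrite -oapp_omap -IH.
  + by rewrite IH oapp_omap.
Qed.

Lemma sat_bot V v : sat S (fbot L V) v = False.
Proof. by []. Qed.

Lemma sat_eq V (s t : term L V) v : sat S (feq s t) v = (eval S v s = eval S v t).
Proof. by []. Qed.

Lemma sat_imp V (phi psi : formula L V) v :
  sat S (fimp phi psi) v = (sat S phi v -> sat S psi v).
Proof. by []. Qed.

Lemma sat_all V (phi : formula L (option V)) v :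
  sat S (fall phi) v = forall x, sat S phi (oapp v x).
Proof. by []. Qed.

Lemma sat_neg V (phi : formula L V) v : sat S (fneg phi) v = ~ sat S phi v.
Proof. by []. Qed.

Lemma sat_and V (phi psi : formula L V) v :
  sat S (fand phi psi) v = (sat S phi v /\ sat S psi v).
Proof.
rewrite propeqE /=; split; last by move=> [? ?] /(_ _) -/(_ _); tauto.
by move=> H; apply: contrapT => H'; apply: H => ? ?; apply: H'.
Qed.

Lemma sat_or V (phi psi : formula L V) v :
  sat S (for_ phi psi) v = (sat S phi v \/ sat S psi v).
Proof.
rewrite propeqE /=; split; last by case.
by move=> H; have [?|?] := pselect (sat S phi v); [left|right; exact: H].
Qed.

Lemma sat_ex V (phi : formula L (option V)) v :
  sat S (fex phi) v = exists x, sat S phi (oapp v x).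
Proof.
rewrite propeqE /=; split; last by move=> [x ?] /(_ x).
by move=> H; apply: contrapT => H'; apply: H => x ?; apply: H'; exists x.
Qed.

End Syntax.

Section Support.
Variable L : language.

Lemma term_support V (t : term L V) : exists2 B : set V, finite_set B &
  forall M (S : structure L M) v v',
    (forall i, B i -> v i = v' i) -> eval S v t = eval S v' t.
Proof.
elim: t => [x|f ts IH].
  by exists [set x]; [exact: finite_set1|move=> M S v v' /=; exact].
have /choice[B HB] : forall i, exists B : set V, finite_set B /\
  forall M (S : structure L M) v v',
    (forall i, B i -> v i = v' i) -> eval S v (ts i) = eval S v' (ts i).
  by move=> i; have [B ? ?] := IH i; exists B.
exists (\bigcup_(i in [set: 'I_(farity f)]) B i).
  by apply: bigcup_finite => // i _; have [] := HB i.
move=> M S v v' vv' /=; congr finterp; apply/funext => i.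
by have [_] := HB i; apply=> j Bj; apply: vv'; exists i.
Qed.

(** The support is chosen before the structure, because [universal_closure] evaluates one formula in
    all structures. *)
Lemma formula_support V (phi : formula L V) : exists2 B : set V, finite_set B &
  forall M (S : structure L M) v v',
    (forall i, B i -> v i = v' i) -> sat S phi v = sat S phi v'.
Proof.
elim: phi => [{}V|{}V s t|{}V r ts|{}V phi [B Bf IH1] psi [C Cf IH2]|{}V phi [B Bf IH]].
- by exists set0.
- have [B Bf HB] := term_support s; have [C Cf HC] := term_support t.
  exists (B `|` C); first by rewrite finite_setU.
  move=> M S v v' vv' /=.
  by rewrite (HB _ S v v') ?(HC _ S v v')// => i ?; apply: vv'; [right|left].
- have /choice[B HB] : forall i, exists B : set V, finite_set B /\
    forall M (S : structure L M) v v',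
      (forall i, B i -> v i = v' i) -> eval S v (ts i) = eval S v' (ts i).
    by move=> i; have [B ? ?] := term_support (ts i); exists B.
  exists (\bigcup_(i in [set: 'I_(rarity r)]) B i).
    by apply: bigcup_finite => // i _; have [] := HB i.
  move=> M S v v' vv' /=; congr rinterp; apply/funext => i.
  by have [_] := HB i; apply=> j Bj; apply: vv'; exists i.
- exists (B `|` C); first by rewrite finite_setU.
  move=> M S v v' vv' /=.
  by rewrite (IH1 _ S v v') ?(IH2 _ S v v')// => i ?; apply: vv'; [right|left].
- exists (Some @^-1` B); first by apply: finite_preimage => // ? ? _ _ [].
  move=> M S v v' vv' /=; rewrite propeqE.
  by split=> + x => /(_ x); rewrite (IH _ S (oapp v x) (oapp v' x))// => -[i|]//= /vv'.
Qed.

End Support.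

(** Nested options, so that the variable [None] is exactly what [fall] binds and [fclose] can
    quantify by recursion. *)
Fixpoint fin (n : nat) : Type := if n is m.+1 then option (fin m) else void.

Fixpoint fin_of (n k : nat) : fin n.+1 :=
  match n, k with
  | m.+1, k'.+1 => Some (fin_of m k')
  | _, _ => None
  end.

Fixpoint fin_nat (n : nat) : fin n -> nat :=
  match n return fin n -> nat with
  | 0 => fun=> 0
  | m.+1 => fun i => if i is Some j then (fin_nat j).+1 else 0
  end.

Lemma fin_ofK n k : k <= n -> fin_nat (fin_of n k) = k.
Proof. by elim: n k => [|n IH] [|k]// kn; congr _.+1; exact: IH. Qed.

Lemma finite_retract V (B : set V) : finite_set B ->
  exists n (h : V -> fin n) (g : fin n -> V), forall x, B x -> g (h x) = x.
Proof.
move=> /(@finite_seqP {classic V})[s ->].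
have [[x0]|V0] := pselect (inhabited V).
  (* Points outside [s] get the index [size s], hence the successor. *)
  exists (size s).+1, (fun x => fin_of (size s) (@index {classic V} x s)),
    (fun i => nth x0 s (fin_nat i)) => x xs.
  rewrite -[RHS](@nth_index {classic V} x0 x s xs); congr nth.
  by apply: fin_ofK; exact: index_size.
have V_void (x : V) : False by apply: V0; exists.
by exists 0, (fun x => False_rect void (V_void x)), (@of_void V) => x _; case: (V_void x).
Qed.

Lemma finite_fin n : finite_set [set: fin n].
Proof.
elim: n => [|n IH]; first by rewrite [X in finite_set X](_ : _ = set0)//; apply/seteqP; split=> -[].
apply: (@sub_finite_set _ _ ([set None] `|` Some @` [set: fin n])).
  by move=> [i|] _; [right; exists i|left].
by rewrite finite_setU; split; [exact: finite_set1|exact: finite_image].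
Qed.

(** On the support [g \o h] is the identity, so finitely many values of the assignment determine the
    truth of [phi]. *)
Lemma formula_factor L V (phi : formula L V) :
  exists n (h : V -> fin n) (g : fin n -> V),
  forall M (S : structure L M) v, sat S phi ((v \o g) \o h) = sat S phi v.
Proof.
have [B Bf HB] := formula_support phi.
have [n [h [g gh]]] := finite_retract Bf.
exists n, h, g => M S v; apply: HB => i Bi /=.
by rewrite gh.
Qed.

Fixpoint fclose L n : formula L (fin n) -> sentence L :=
  match n return formula L (fin n) -> sentence L with
  | 0 => id
  | m.+1 => fun phi => fclose (@fall L (fin m) phi)
  end.

Lemma sat_close L n (phi : formula L (fin n)) M (S : structure L M) :
  sat S (fclose phi) (of_void M) <-> forall v, sat S phi v.
Proof.
elim: n phi => [|n IH] phi /=.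
  by split=> [H v|]//; rewrite (_ : v = of_void M)//; apply/funext => -[].
rewrite IH /=; split=> H v.
  have := H (v \o Some) (v None); congr sat.
  by apply/funext => -[].
by move=> x; exact: H.
Qed.

(** The first clause asks for assignments of finite range only, because lovely pairs realize types
    over finite sets. *)
Lemma universal_closure L V (phi : formula L V) : exists sigma : sentence L,
  (forall M (S : structure L M),
    (forall v, finite_set (range v) -> sat S phi v) -> theory_of S sigma) /\
  (forall M (S : structure L M),
    theory_of S sigma -> forall v, sat S phi v).
Proof.
have [n [h [g gh]]] := formula_factor phi.
exists (fclose (frename h phi)); split=> M S; rewrite /theory_of/= sat_close => H v.
- rewrite sat_rename; apply: H.
  apply: (@sub_finite_set _ _ (range v)); first by move=> _ [x _ <-]; exists (h x).
  exact/finite_image/finite_fin.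
- by rewrite -gh -sat_rename.
Qed.

(** * Definable sets and definable closure *)

Section Definable.
Variables (L : language) (M : Type) (S : structure L M).
Implicit Types (A B : set M) (V W : Type).

Definition param_env A V (v : V -> M) (z : V + A) : M :=
  match z with inl i => v i | inr a => \val a end.

(** A predicate on assignments rather than a formula: the closure lemmas then apply to ordinary
    propositions, and a quantifier is met by passing to [option V]. *)
Definition dfn A V (X : (V -> M) -> Prop) :=
  exists phi : formula L (V + A), forall v, X v = sat S phi (param_env v).

Definition dft A V (t : (V -> M) -> M) :=
  exists u : term L (V + A), forall v, t v = eval S (param_env v) u.

Definition dfn1 A (D : M -> Prop) := dfn A (fun v : unit -> M => D (v tt)).
Definition dfn2 A (Q : M -> M -> Prop) :=
  dfn A (fun v : bool -> M => Q (v true) (v false)).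

Definition dcl A (x : M) := dfn1 A (eq^~ x).

Lemma dfn_ext A V (X Y : (V -> M) -> Prop) :
  (forall v, X v <-> Y v) -> dfn A X -> dfn A Y.
Proof. by move=> XY [phi H]; exists phi => v; rewrite -H; apply/propext; rewrite XY. Qed.

Lemma dfn_const A V (C : Prop) : dfn A (fun _ : V -> M => C).
Proof.
have [HC|HC] := pselect C; last first.
  by exists (fbot _ _) => v; apply/propext; split.
by exists (fimp (fbot _ _) (fbot _ _)) => v; apply/propext; split=> /=.
Qed.

Lemma dfn_imp A V (X Y : (V -> M) -> Prop) :
  dfn A X -> dfn A Y -> dfn A (fun v => X v -> Y v).
Proof. by move=> [phi HX] [psi HY]; exists (fimp phi psi) => v; rewrite HX HY. Qed.

Lemma dfn_not A V (X : (V -> M) -> Prop) : dfn A X -> dfn A (fun v => ~ X v).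
Proof. by move=> HX; apply: dfn_imp => //; exact: dfn_const. Qed.

Lemma dfn_and A V (X Y : (V -> M) -> Prop) :
  dfn A X -> dfn A Y -> dfn A (fun v => X v /\ Y v).
Proof. by move=> [phi HX] [psi HY]; exists (fand phi psi) => v; rewrite HX HY sat_and. Qed.

Lemma dfn_or A V (X Y : (V -> M) -> Prop) :
  dfn A X -> dfn A Y -> dfn A (fun v => X v \/ Y v).
Proof. by move=> [phi HX] [psi HY]; exists (for_ phi psi) => v; rewrite HX HY sat_or. Qed.

Lemma dfn_sub A V W (X : (V -> M) -> Prop) (h : V -> W) :
  dfn A X -> dfn A (fun w => X (fun i => w (h i))).
Proof.
move=> [phi H]; exists (frename (fun z => match z with inl i => inl (h i) | inr a => inr a end) phi).
move=> w; rewrite sat_rename H; congr sat.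
by apply/funext => -[].
Qed.

Lemma dfn_all A V (X : (V -> M) -> M -> Prop) :
  dfn A (fun w : option V -> M => X (fun i => w (Some i)) (w None)) ->
  dfn A (fun v => forall x, X v x).
Proof.
move=> [phi H]; exists (fall (frename (fun z : option V + A => match z with
  | inl (Some i) => Some (inl i) | inl None => None | inr a => Some (inr a) end) phi)) => v /=.
suff E x : X v x = sat S phi (param_env (A := A) (oapp v x)).
  rewrite propeqE; split=> XX x; have := XX x; rewrite sat_rename E.
    by congr sat; apply/funext => -[[]|].
  by congr sat; apply/funext => -[[]|].
by have := H (oapp v x).
Qed.

Lemma dfn_ex A V (X : (V -> M) -> M -> Prop) :
  dfn A (fun w : option V -> M => X (fun i => w (Some i)) (w None)) ->
  dfn A (fun v => exists x, X v x).
Proof.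
move=> H; apply: (@dfn_ext _ _ (fun v => ~ forall x, ~ X v x)).
  by move=> v; rewrite -existsNE; split=> -[x] => [/contrapT|]; exists x => //; exact.
by apply/dfn_not/dfn_all/dfn_not.
Qed.

Lemma dfn_mono A B V (X : (V -> M) -> Prop) : A `<=` B -> dfn A X -> dfn B X.
Proof.
move=> AB [phi H].
exists (frename (fun z : V + A => match z with inl i => inl i
  | inr a => inr (SigSub (mem_set (AB _ (set_mem (valP a))))) end) phi) => v.
by rewrite H sat_rename; congr sat; apply/funext => -[].
Qed.

Lemma dfn_addE A b V (X : (V -> M) -> Prop) : dfn (b |` A) X ->
  exists2 Y : (option V -> M) -> Prop, dfn A Y & forall v, X v = Y (oapp v b).
Proof.
move=> [phi H].
pose h (z : V + (b |` A)) : option V + A := match z with inl i => inl (Some i)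
  | inr a => match pselect (A (\val a)) with
             | left Aa => inr (SigSub (mem_set Aa)) | right _ => inl None end end.
exists (fun w => sat S (frename h phi) (param_env w)).
  by exists (frename h phi).
move=> v; rewrite H sat_rename; congr sat; apply/funext => -[i//|a] /=.
case: pselect => //= nAa; have := set_mem (valP a); case=> //.
Qed.

Lemma dfn_finite A V (X : (V -> M) -> Prop) : dfn A X ->
  exists B, [/\ finite_set B, B `<=` A & dfn B X].
Proof.
move=> [phi H]; have [n [h [g gh]]] := formula_factor phi.
pose B := [set b | exists i, match g i with inl _ => False | inr a => \val a = b end].
exists B; split.
- have /finite_image HF := finite_fin n.
  pose f (i : fin n) : set M := match g i with inl _ => set0 | inr a => [set \val a] end.
  apply: (@sub_finite_set _ _ (\bigcup_(i in [set: fin n]) f i)).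
    by move=> b [i] gi; exists i => //; rewrite /f; case: (g i) gi.
  apply: bigcup_finite; first exact: finite_fin.
  by move=> i _; rewrite /f; case: (g i) => [|a]; rewrite /= ?finite_set0//; exact: finite_set1.
- by move=> b [i]; case: (g i) => // a <-; exact: (set_mem (valP a)).
- have /choice[g' Hg'] i : exists z : V + B, forall v, param_env v z = param_env v (g i).
    case E : (g i) => [j|a]; first by exists (inl j).
    have Ba : B (\val a) by exists i; rewrite E.
    by exists (inr (SigSub (mem_set Ba))).
  exists (frename g' (frename h phi)) => v.
  rewrite H !sat_rename -gh; congr sat; apply/funext => i /=.
  by rewrite Hg'.
Qed.

Lemma dft_var A V (i : V) : dft A (fun v => v i).
Proof. by exists (tvar _ (inl i)). Qed.

Lemma dft_par A V b : A b -> dft A (fun _ : V -> M => b).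
Proof. by move=> Ab; exists (tvar _ (inr (SigSub (mem_set Ab)))). Qed.

Lemma dfn_eq A V (s t : (V -> M) -> M) :
  dft A s -> dft A t -> dfn A (fun v => s v = t v).
Proof. by move=> [s' Hs] [t' Ht]; exists (feq s' t') => v /=; rewrite Hs Ht. Qed.

Lemma dfn1_app A V (D : M -> Prop) (i : V) : dfn1 A D -> dfn A (fun v => D (v i)).
Proof. by move=> HD; exact: (dfn_sub (fun=> i) HD). Qed.

Lemma dfn2_app A V (Q : M -> M -> Prop) (i j : V) :
  dfn2 A Q -> dfn A (fun v => Q (v i) (v j)).
Proof. by move=> HQ; exact: (dfn_sub (fun b : bool => if b then i else j) HQ). Qed.

Lemma dfn_dcl A V b (i : V) : dcl A b -> dfn A (fun v => v i = b).
Proof. exact: (@dfn1_app _ _ (eq^~ b)). Qed.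

Lemma dcl_par A a : A a -> dcl A a.
Proof. by move=> Aa; apply: dfn_eq; [exact: dft_var|exact: dft_par]. Qed.

Lemma dft_sub A V W (h : V -> W) (t : (V -> M) -> M) :
  dft A t -> dft A (fun w => t (fun i => w (h i))).
Proof.
move=> [u H].
exists (trename (fun z => match z with inl i => inl (h i) | inr a => inr a end) u) => w.
by rewrite eval_rename H; congr eval; apply/funext => -[].
Qed.

Lemma dfn1_term A V (D : M -> Prop) (t : (V -> M) -> M) :
  dfn1 A D -> dft A t -> dfn A (fun v => D (t v)).
Proof.
move=> HD Ht; apply: (@dfn_ext _ _ (fun v => exists x, x = t v /\ D x)).
  by move=> v; split=> [[x [->]]|]//; exists (t v).
apply: dfn_ex; apply: dfn_and; last exact: dfn1_app.
by apply: dfn_eq; [exact: dft_var|exact: dft_sub].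
Qed.

Lemma dfn2_term A V (Q : M -> M -> Prop) (s t : (V -> M) -> M) :
  dfn2 A Q -> dft A s -> dft A t -> dfn A (fun v => Q (s v) (t v)).
Proof.
move=> HQ Hs Ht.
apply: (@dfn_ext _ _ (fun v => exists x y, (x = s v /\ y = t v) /\ Q x y)).
  by move=> v; split=> [[x [y [[-> ->]]]]|]//; exists (s v), (t v).
apply: dfn_ex; apply: dfn_ex; apply: dfn_and; last exact: dfn2_app.
apply: dfn_and; apply: dfn_eq; try exact: dft_var.
  exact: (dft_sub (fun i : V => Some (Some i))).
exact: (dft_sub (fun i : V => Some (Some i))).
Qed.

Lemma dcl_mono A B x : A `<=` B -> dcl A x -> dcl B x.
Proof. exact: dfn_mono. Qed.

(** The parameter [b] becomes a bound variable constrained by the definition of [b] over [A]. *)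
Lemma dfn_dcl_add A b V (X : (V -> M) -> Prop) :
  dcl A b -> dfn (b |` A) X -> dfn A X.
Proof.
move=> Ab /dfn_addE[Y HY XY].
apply: (@dfn_ext _ _ (fun v => exists x, x = b /\ Y (oapp v x))).
  by move=> v; rewrite XY; split=> [[x [->]]|]//; exists b.
apply: dfn_ex; apply: dfn_and; first exact: dfn_dcl.
apply: (dfn_ext _ HY) => w.
by rewrite (_ : oapp _ _ = w)//; apply/funext => -[].
Qed.

(** Only finitely many parameters occur, and they are eliminated one at a time. *)
Lemma dfn_trans A B V (X : (V -> M) -> Prop) :
  (forall b, B b -> dcl A b) -> dfn B X -> dfn A X.
Proof.
move=> BA /dfn_finite[C [Cf CB]].
have {CB BA} : forall b, C b -> dcl A b by move=> b /CB /BA.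
move=> CA HX; have {HX} : dfn (C `|` A) X by apply: dfn_mono HX; exact: subsetUl.
elim/finite_set_rect_prop : Cf CA X => [_|b {}C Cf IH CA] X; first by rewrite set0U.
rewrite -setUA => /dfn_dcl_add HX; apply: IH; first by move=> c Cc; apply: CA; right.
by apply: HX; apply: (@dcl_mono A); [exact: subsetUr|apply: CA; left].
Qed.

Lemma dcl_trans A B x : (forall b, B b -> dcl A b) -> dcl B x -> dcl A x.
Proof. exact: dfn_trans. Qed.

Lemma definable_overE A (D : set M) : definable_over S A D <-> dfn1 A D.
Proof.
split=> [[phi ->]|[phi H]].
  exists (frename (fun z : option A => if z is Some a then inr a else inl tt) phi) => v.
  by rewrite sat_rename /solutions/=; congr sat; apply/funext => -[].
exists (frename (fun z : unit + A => if z is inr a then Some a else None) phi).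
apply/funext => x; rewrite /solutions/= sat_rename (H (fun=> x)).
by congr sat; apply/funext => -[].
Qed.

Lemma dfn1_params B W (p : W -> M) (psi : formula L (option W)) :
  (forall i, B (p i)) -> dfn1 B (fun x => sat S psi (oapp p x)).
Proof.
move=> Bp; exists (frename (fun o : option W =>
  if o is Some i then inr (SigSub (mem_set (Bp i))) else inl tt) psi) => v.
by rewrite sat_rename; congr sat; apply/funext => -[].
Qed.

Lemma dcl_acl A x : dcl A x -> acl S A x.
Proof.
move=> /(iffRL (definable_overE A (eq^~ x))) [phi H]; exists phi.
by rewrite -H; split=> //; exact: finite_set1.
Qed.

End Definable.

Lemma filter_bigcap_finite (T I : Type) (F : set_system T) (B : set I) (f : I -> set T) :
  Filter F -> finite_set B -> (forall i, B i -> F (f i)) ->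
  F (\bigcap_(i in B) f i).
Proof.
move=> FF Bf; elim/finite_set_rect_prop : Bf => [_|i {}B _ IH H].
  by rewrite bigcap_set0; exact: filterT.
rewrite bigcap_setU1; apply: filterI; first by apply: H; left.
by apply: IH => j Bj; apply: H; right.
Qed.

Lemma fip_ultra (T : Type) (B : set (set T)) :
  (forall F, finite_set F -> F `<=` B -> exists x, forall D, F D -> D x) ->
  exists U : set_system T, UltraFilter U /\ B `<=` U.
Proof.
move=> Bfip.
have FB : finI (I := {classic set T}) B id.
  move=> D' D'B; have [||x Hx] := Bfip [set` finmap.enum_fset D'].
  - by apply/(@finite_seqP {classic set T}); exists (finmap.enum_fset D').
  - by move=> D DD'; apply: set_mem; exact: D'B.
  - by exists x => D /= /Hx.
have [U [UU FU]] := ultraFilterLemma (finI_filter FB).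
exists U; split=> // D BD; apply: FU.
by exists D => //; exact: (@finI_from1 {classic set T}).
Qed.

(* A finitely satisfiable family of definable sets extends to a complete type. *)
Lemma saturated_fip (L : language) (M : Type) (S : structure L M) (A : set M)
    (B : set (set M)) :
  saturated S -> card_lt A [set: M] -> (forall D, B D -> dfn1 S A D) ->
  (forall F, finite_set F -> F `<=` B -> exists x, forall D, F D -> D x) ->
  exists x, forall D, B D -> D x.
Proof.
move=> satS Asmall Bdef /fip_ultra[U [UU BU]].
pose q : set (formula1 L A) := [set phi | U (solutions S phi)].
have [|x Hx] := satS A q Asmall.
  split=> [q0 q0q q0f|phi]; last first.
    by have [|] := in_ultra_setVsetC (solutions S phi) UU; [left|right].
  have : U (\bigcap_(phi in q0) solutions S phi).
    exact: filter_bigcap_finite.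
  by move=> /filter_ex [x Hx]; exists x.
exists x => D BD; have /definable_overE[phi Dphi] := Bdef _ BD.
by rewrite Dphi; apply: Hx; rewrite /q/= -Dphi; exact: BU.
Qed.

(** * Transfer from the real line *)

Lemma tarski_vaught (L : language) (M : Type) (S : structure L M) (A : set M) :
  (forall D : set M, dfn1 S A D -> D !=set0 -> exists x, A x /\ D x) ->
  exists S' : structure L A, forall V (phi : formula L V) (v : V -> A),
    sat S' phi v = sat S phi (fun i => \val (v i)).
Proof.
move=> TV.
(* The value of a function symbol at points of [A] is the only point of an [A]-definable set, so it
   lies in [A]. *)
have /choice[g Hg] : forall fv : {f : Defs.fsym L & 'I_(farity f) -> A}, exists a : A,
    \val a = finterp S (f := projT1 fv) (fun i => \val (projT2 fv i)).
  move=> [f v] /=; have [||x [Ax Dx]] := TV (eq^~ (finterp S (f := f) (fun i => \val (v i)))).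
  - exists (feq (tvar L (inl tt)) (tapp (fun i => tvar L (inr (v i))))) => w.
    by [].
  - by exists (finterp S (f := f) (fun i => \val (v i))).
  - by exists (SigSub (mem_set Ax)).
pose S' : structure L A := {|
  finterp := fun f v => g (existT _ f v);
  rinterp := fun r v => rinterp S (fun i => \val (v i)) |}.
have evalS' V (v : V -> A) (t : term L V) :
    \val (eval S' v t) = eval S (fun i => \val (v i)) t.
  elim: t => [x|f ts IH] //=.
  by rewrite Hg /=; congr finterp; apply/funext => i; rewrite IH.
exists S' => V phi; elim: phi => {V} /= [//|V s t|V r ts|V phi IH1 psi IH2|V phi IH] v.
- rewrite propeqE -!evalS'; split=> [->//|]; exact: val_inj.
- by congr rinterp; apply/funext => i; rewrite evalS'.
- by rewrite IH1 IH2.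
- have oappv (x : A) : (fun i => \val (oapp v x i)) = oapp (fun i => \val (v i)) (\val x).
    by apply/funext => -[].
  rewrite propeqE; split=> H x; last by rewrite IH oappv.
  apply: contrapT => Hx.
  have [||y [Ay]] := TV (fun x => ~ sat S phi (oapp (fun i => \val (v i)) x)).
  + exists (fneg (frename (fun o : option V => if o is Some i then inr (v i) else inl tt) phi)) => w.
    by rewrite sat_neg sat_rename; congr (~ sat _ _ _); apply/funext => -[].
  + by exists x.
  + by apply; have := H (SigSub (mem_set Ay)); rewrite IH oappv.
Qed.

(** * Symbols of the ordered group and reification *)

Section OrderedGroupLanguage.
Variable L' : language.
Let L := lang_sum ogroup_lang L'.

Definition two (T : Type) (x y : T) (i : 'I_2) : T :=
  match nat_of_ord i with 0 => x | _ => y end.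

Definition slt (M : Type) (S : structure L M) (x y : M) : Prop :=
  rinterp S (r := inl tt) (two x y).

Definition sadd (M : Type) (S : structure L M) (x y : M) : M :=
  finterp S (f := inl tt) (two x y).

Definition flt V (s t : term L V) : formula L V :=
  @Defs.frel L V (inl tt) (two s t).

Definition tadd V (s t : term L V) : term L V := @tapp L V (inl tt) (two s t).

Lemma sat_lt M (S : structure L M) V (s t : term L V) v :
  sat S (flt s t) v = slt S (eval S v s) (eval S v t).
Proof.
rewrite /=; congr rinterp; apply/funext => i.
by rewrite /two; case: (nat_of_ord i).
Qed.

Lemma eval_add M (S : structure L M) V (s t : term L V) v :
  eval S v (tadd s t) = sadd S (eval S v s) (eval S v t).
Proof.
rewrite /=; congr finterp; apply/funext => i.
by rewrite /two; case: (nat_of_ord i).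
Qed.

Lemma dfn_lt M (S : structure L M) (A : set M) V (s t : (V -> M) -> M) :
  dft S A s -> dft S A t -> dfn S A (fun v => slt S (s v) (t v)).
Proof. by move=> [s' Hs] [t' Ht]; exists (flt s' t') => v; rewrite Hs Ht sat_lt. Qed.

Lemma dft_add M (S : structure L M) (A : set M) V (s t : (V -> M) -> M) :
  dft S A s -> dft S A t -> dft S A (fun v => sadd S (s v) (t v)).
Proof. by move=> [s' Hs] [t' Ht]; exists (tadd s' t') => v; rewrite Hs Ht eval_add. Qed.

End OrderedGroupLanguage.

Definition satE := (sat_lt, eval_add, sat_and, sat_ex, sat_or, sat_neg, sat_eq, sat_imp, sat_bot, sat_all).

(** [og_index], [og_term] and [og_formula] reify a statement about the elements of a list as a
    formula over [nat]; variable [n] stands for the [n]-th element. *)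
Ltac og_index x l :=
  lazymatch l with
  | x :: _ => constr:(0%N)
  | _ :: ?l' => let n := og_index x l' in constr:(n.+1)
  end.

Ltac og_term L' l t :=
  lazymatch t with
  | sadd _ ?a ?b =>
      let a' := og_term L' l a in let b' := og_term L' l b in
      constr:(@tadd L' nat a' b')
  | ?x => let n := og_index x l in constr:(@tvar (lang_sum ogroup_lang L') nat n)
  end.

Ltac og_formula L' l P :=
  lazymatch P with
  | False => constr:(fbot (lang_sum ogroup_lang L') nat)
  | ~ ?A => let A' := og_formula L' l A in constr:(fneg A')
  | ?A -> ?B =>
      let A' := og_formula L' l A in let B' := og_formula L' l B in constr:(fimp A' B')
  | ?A /\ ?B =>
      let A' := og_formula L' l A in let B' := og_formula L' l B in constr:(fand A' B')
  | ?A \/ ?B =>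
      let A' := og_formula L' l A in let B' := og_formula L' l B in constr:(for_ A' B')
  | slt _ ?a ?b =>
      let a' := og_term L' l a in let b' := og_term L' l b in constr:(@flt L' nat a' b')
  | ?a = ?b =>
      let a' := og_term L' l a in let b' := og_term L' l b in constr:(feq a' b')
  end.

Section OMinimal.
Variables (R : realType) (L' : language) (E : structure L' R).
Let L := lang_sum ogroup_lang L'.
Let SR : structure L R := struct_sum (ogroup_struct R) E.

Lemma slt_real x y : slt SR x y = (x < y)%R :> Prop.
Proof. by []. Qed.

Lemma sadd_real x y : sadd SR x y = (x + y)%R.
Proof. by []. Qed.

Hypothesis omin : o_minimal SR.

(** Unlike finiteness, this is first-order in a definable set. O-minimality is used mostly in the
    form that definable sets without interior are finite. *)
Definition noint (M : Type) (S : structure L M) (D : set M) : Prop :=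
  forall a b, slt S a b -> exists x, [/\ slt S a x, slt S x b & ~ D x].

Definition lub (M : Type) (S : structure L M) (D : set M) (s : M) : Prop :=
  (forall x, D x -> ~ slt S s x) /\
  (forall b, (forall x, D x -> ~ slt S b x) -> ~ slt S b s).

Lemma real_definable V (phi : formula L (option V)) (v : V -> R) :
  exists s : seq (interval R),
    [set x | sat SR phi (oapp v x)] = [set x | exists2 i, i \in s & x \in i].
Proof.
apply: omin.
exists (frename (omap (fun i => SigSub (mem_set (I : [set: R] (v i))))) phi).
apply/funext => x; rewrite /solutions/= sat_rename.
by congr sat; apply/funext => -[].
Qed.

Lemma mem_itv_convex (i : interval R) x y z :
  x \in i -> z \in i -> (x < y)%R -> (y < z)%R -> y \in i.
Proof. by case: i => -[[] a|[]] [[] b|[]]; rewrite !in_itv //=; lra. Qed.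

(** An interval of the decomposition is convex, so it has at most one point if it has no
    interior. *)
Lemma real_noint_finite V (phi : formula L (option V)) (v : V -> R) :
  noint SR [set x | sat SR phi (oapp v x)] ->
  finite_set [set x | sat SR phi (oapp v x)].
Proof.
have [s ->] := real_definable phi v => Hs.
rewrite (_ : mkset _ = \bigcup_(i in [set` s]) [set` i]); last first.
  by apply/seteqP; split=> [x [i si xi]|x [i si xi]]; exists i.
apply: bigcup_finite; first by apply/finite_seqP; exists s.
move=> i /= si; have [[x xi]|ni] := pselect ([set` i] !=set0); last first.
  by rewrite (_ : [set` i] = set0)//; apply: contrapT => /eqP/set0P.
apply: (@sub_finite_set _ _ [set x]); last exact: finite_set1.
have H a b : a \in i -> b \in i -> ~ (a < b)%R.
  move=> ai bi ab; have [y [ay yb]] := Hs _ _ ab.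
  apply; exists i => //.
  exact: (mem_itv_convex ai bi).
by move=> y yi /=; case: (ltgtP x y) => // /H; case=> //.
Qed.

Lemma real_right_const V (phi : formula L (option V)) (v : V -> R) i :
  exists j, slt SR i j /\
    ((forall x, slt SR i x -> slt SR x j -> sat SR phi (oapp v x)) \/
     (forall x, slt SR i x -> slt SR x j -> ~ sat SR phi (oapp v x))).
Proof.
have [s Hs] := real_definable phi v.
have {}Hs x : sat SR phi (oapp v x) <-> exists2 k, k \in s & x \in k.
  by have := congr1 (fun D : set R => D x) Hs => /= ->.
suff [j [ij H]] : exists j, slt SR i j /\
    ((forall x, slt SR i x -> slt SR x j -> exists2 k, k \in s & x \in k) \/
     (forall x, slt SR i x -> slt SR x j -> ~ exists2 k, k \in s & x \in k)).
  exists j; split=> //; case: H => H; [left|right] => x ix xj; first exact/Hs/H.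
  by move=> /Hs; apply: H.
elim: s {Hs} => [|k s [j [ij IH]]].
  by exists (i + 1)%R; split; [rewrite slt_real; lra|right => x _ _ []].
case: IH => IH.
  by exists j; split=> //; left => x ix /(IH _ ix) [l ls xl]; exists l; rewrite // inE ls orbT.
have [[j' [ij' H]]|nj] := pselect (exists j', (i < j')%R /\ forall x, (i < x)%R -> (x < j')%R -> ~ x \in k).
  exists (Num.min j j'); split; first by rewrite slt_real lt_min ij' andbT.
  right => x ix; rewrite slt_real lt_min => /andP[xj xj'] [l].
  rewrite inE => /predU1P[-> |ls] xl; first exact: H xl.
  by apply: (IH _ ix xj); exists l.
(* Here [k] meets every right neighbourhood of [i], so by convexity it contains some [(i, y)]. *)
have Hk j' : (i < j')%R -> exists x, [/\ (i < x)%R, (x < j')%R & x \in k].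
  move=> ij'; apply: contrapT => Hx; apply: nj; exists j'; split=> // x ix xj xk.
  by apply: Hx; exists x.
have [y [iy _ yk]] := Hk _ (ltr_pwDr ltr01 (lexx i)).
exists y; split=> //; left => x ix xy; have [z [iz zx zk]] := Hk _ ix.
exists k; first by rewrite inE eqxx.
exact: (mem_itv_convex zk yk).
Qed.

Lemma real_complete (D : set R) : D !=set0 ->
  (exists b, forall x, D x -> ~ slt SR b x) -> exists s, lub SR D s.
Proof.
move=> D0 [b Hb].
have supD : has_sup D.
  by split=> //; exists b => x /Hb /negP; rewrite -leNgt.
exists (sup D); split=> [x Dx|c Hc]; apply/negP; rewrite -leNgt.
  exact: ub_le_sup (proj2 supD) _ Dx.
by apply: ge_sup => // x /Hc /negP; rewrite -leNgt.
Qed.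

Section Transfer.
Variables (M : Type) (S : structure L M).
Hypothesis SSR : theory_of S = theory_of SR.

Lemma transfer V (phi : formula L V) :
  (forall v, sat SR phi v) -> forall v, sat S phi v.
Proof.
move=> H; have [sigma [s1 s2]] := universal_closure phi.
by apply: s2; rewrite SSR; apply: s1.
Qed.

Local Notation "x <' y" := (slt S x y) (at level 70).

(** For a fixed [phi] the dichotomy is a single formula in the parameters, so it transfers, although
    o-minimality itself quantifies over formulas. *)
Lemma right_const_formula V (phi : formula L (option V)) (v : V -> M) i :
  exists j, i <' j /\
    ((forall x, i <' x -> x <' j -> sat S phi (oapp v x)) \/
     (forall x, i <' x -> x <' j -> ~ sat S phi (oapp v x))).
Proof.
pose h (o : option V) : option (option (option V)) := omap (Some \o Some) o.
pose X k := tvar L k : term L (option (option (option V))).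
pose psi := fall (fex (fand (flt (tvar L (Some None)) (tvar L None))
  (for_ (fall (fimp (flt (X (Some (Some None))) (X None))
          (fimp (flt (X None) (X (Some None))) (frename h phi))))
        (fall (fimp (flt (X (Some (Some None))) (X None))
          (fimp (flt (X None) (X (Some None))) (fneg (frename h phi)))))))).
have psiP N (S' : structure L N) (w : V -> N) : sat S' psi w =
    forall i, exists j, slt S' i j /\
    ((forall x, slt S' i x -> slt S' x j -> sat S' phi (oapp w x)) \/
     (forall x, slt S' i x -> slt S' x j -> ~ sat S' phi (oapp w x))).
  have hE a b x : oapp (oapp (oapp w a) b) x \o h = oapp w x.
    by apply/funext => -[].
  rewrite /psi !satE; apply: eq_forall => a; rewrite !satE; apply: eq_exists => b.
  rewrite sat_and sat_lt sat_or; congr (_ /\ (_ \/ _)).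
    by rewrite sat_all; apply: eq_forall => x; rewrite !satE sat_rename hE.
  by rewrite sat_all; apply: eq_forall => x; rewrite !satE sat_rename hE.
have := @transfer V psi _ v; rewrite psiP => H; move: i; apply: H => w.
by rewrite psiP => i; exact: real_right_const.
Qed.

Lemma complete_formula V (phi : formula L (option V)) (v : V -> M) :
  [set x | sat S phi (oapp v x)] !=set0 ->
  (exists b, forall x, sat S phi (oapp v x) -> ~ b <' x) ->
  exists s, lub S [set x | sat S phi (oapp v x)] s.
Proof.
pose h (o : option V) : option (option V) := omap Some o.
pose h' (o : option V) : option (option (option V)) := omap (Some \o Some) o.
pose psi : formula L V := fimp (fex phi) (fimp
  (fex (fall (fimp (frename h phi) (fneg (flt (tvar L (Some None)) (tvar L None))))))
  (fex (fand (fall (fimp (frename h phi) (fneg (flt (tvar L (Some None)) (tvar L None)))))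
    (fall (fimp (fall (fimp (frename h' phi) (fneg (flt (tvar L (Some None)) (tvar L None)))))
      (fneg (flt (tvar L None) (tvar L (Some None))))))))).
have psiP N (S' : structure L N) (w : V -> N) : sat S' psi w =
    ((exists x, sat S' phi (oapp w x)) ->
    (exists b, forall x, sat S' phi (oapp w x) -> ~ slt S' b x) ->
    exists s, lub S' [set x | sat S' phi (oapp w x)] s).
  have hE a x : oapp (oapp w a) x \o h = oapp w x by apply/funext => -[].
  have hE' a b x : oapp (oapp (oapp w a) b) x \o h' = oapp w x by apply/funext => -[].
  rewrite /psi sat_imp sat_ex sat_imp sat_ex sat_ex.
  congr (_ -> _ -> _).
    by apply: eq_exists => b; rewrite sat_all; apply: eq_forall => x; rewrite !satE sat_rename hE.
  apply: eq_exists => s; rewrite sat_and; congr (_ /\ _).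
    by rewrite sat_all; apply: eq_forall => x; rewrite !satE sat_rename hE.
  rewrite sat_all; apply: eq_forall => b; rewrite sat_imp sat_neg sat_lt; congr (_ -> _).
  by rewrite sat_all; apply: eq_forall => x; rewrite !satE sat_rename hE'.
have := @transfer V psi _ v; rewrite psiP; apply => w.
by rewrite psiP; exact: real_complete.
Qed.

Variable A : set M.

Lemma right_const D i : dfn1 S A D -> exists j, i <' j /\
  ((forall x, i <' x -> x <' j -> D x) \/ (forall x, i <' x -> x <' j -> ~ D x)).
Proof. by move=> /definable_overE [phi ->]; exact: right_const_formula. Qed.

Lemma definably_complete (D : set M) : dfn1 S A D -> D !=set0 ->
  (exists b, forall x, D x -> ~ b <' x) -> exists s, lub S D s.
Proof. by move=> /definable_overE [phi ->]; exact: complete_formula. Qed.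

End Transfer.
End OMinimal.

(* [og_with SSR l] proves an order-group fact about the elements [l] by proving it for
   real numbers; [SSR] says that the structure is elementarily equivalent to the reals. *)
Ltac og_with SSR l :=
  lazymatch goal with |- ?P =>
  lazymatch type of SSR with _ = theory_of ?SR =>
    let L' := lazymatch P with
              | context [@slt ?L' _ _ _ _] => L' | context [@sadd ?L' _ _ _ _] => L' end in
    let f := og_formula L' l P in
    let x := lazymatch l with ?x :: _ => x end in
    let H := fresh in
    assert (H : forall v, sat SR f v);
    [ move=> ?; rewrite ?satE ?slt_real ?sadd_real /=
    | have := transfer SSR H (nth x l); rewrite ?satE /=; exact ]
  end end.

(** * Uniform finiteness for one-parameter families *)

Ltac dfn_step :=
  lazymatch goal with
  | |- dfn _ _ (fun _ => ?P) => exact: dfn_const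
  | |- dfn _ _ (fun v => (forall x : _, _) -> _) => apply: dfn_imp
  | |- dfn _ _ (fun v => (exists x : _, _) -> _) => apply: dfn_imp
  | |- dfn _ _ (fun v => _ /\ _) => apply: dfn_and
  | |- dfn _ _ (fun v => _ \/ _) => apply: dfn_or
  | |- dfn _ _ (fun v => ~ _) => apply: dfn_not
  | |- dfn _ _ (fun v => exists x, _) => apply: dfn_ex
  | |- dfn _ _ (fun v => _ = _) => apply: dfn_eq
  | |- dfn _ _ (fun v => slt _ _ _) => apply: dfn_lt
  | |- dft _ _ (fun v => v _) => exact: dft_var
  | |- dft _ _ (fun _ => _) => first [apply: dft_par; by [] | apply: dft_add]
  | |- dft _ _ (fun v => sadd _ _ _) => apply: dft_add
  | H : dfn1 _ _ ?D |- dfn _ _ (fun v => ?D _) => apply: (dfn1_term H)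
  | H : dfn2 _ _ ?Q |- dfn _ _ (fun v => ?Q _ _) => apply: (dfn2_term H)
  | |- dfn _ _ (fun v => _ -> _) => first [apply: dfn_imp | apply: dfn_all]
  end.

Ltac dfn_solve := rewrite /dfn1 /dfn2; cbv beta; repeat dfn_step.

Section OMinimal.
Variables (R : realType) (L' : language) (E : structure L' R).
Let L := lang_sum ogroup_lang L'.
Let SR : structure L R := struct_sum (ogroup_struct R) E.
Hypothesis omin : o_minimal SR.
Variables (M : Type) (S : structure L M).
Hypothesis SSR : theory_of S = theory_of SR.

Local Notation "x <' y" := (slt S x y) (at level 70).
Local Notation "x +' y" := (sadd S x y) (at level 50, left associativity).

Ltac og l := og_with SSR l.

(** * Order and group facts transferred from the reals *)

Lemma slt_irr x : ~ x <' x.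
Proof. og [:: x]. by rewrite ltxx. Qed.

Lemma slt_trans x y z : x <' y -> y <' z -> x <' z.
Proof. og [:: x; y; z]; lra. Qed.

Lemma slt_total x y : x <' y \/ x = y \/ y <' x.
Proof. og [:: x; y]. by case: ltgtP => ?; [left|right; right|right; left]. Qed.

Lemma slt_le_trans x y z : x <' y -> ~ z <' y -> x <' z.
Proof. by have [yz xy _|[->|]] := slt_total y z => //; exact: slt_trans yz. Qed.

Lemma sle_lt_trans x y z : ~ y <' x -> y <' z -> x <' z.
Proof. by have [xy _ yz|[->|]] := slt_total x y => //; exact: slt_trans yz. Qed.

(** For existential facts: the formula is given explicitly, and the witness is chosen in the
    reals. *)
Ltac og_ex f w :=
  let H := fresh in
  assert (H : forall v, sat SR f v);
  [ move=> v; rewrite ?satE | have := transfer SSR H w; rewrite ?satE; clear H ].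

Lemma slt_dense x y : x <' y -> exists z, x <' z /\ z <' y.
Proof.
og_ex (fimp (flt (tvar L 0%N) (tvar L 1%N)) (fex (fand
  (flt (tvar L (Some 0%N)) (tvar L None)) (flt (tvar L None) (tvar L (Some 1%N))))))
  (nth x [:: x; y]).
  move=> v01; exists ((v 0%N + v 1%N) / 2)%R.
  by move: v01; rewrite !satE !slt_real /=; lra.
by move=> + xy => /(_ xy) [z]; rewrite !satE; exists z.
Qed.

Lemma ex_gt x : exists y, x <' y.
Proof.
og_ex (fex (flt (tvar L (Some 0%N)) (tvar L None))) (fun _ : nat => x).
  by exists (v 0%N + 1)%R; rewrite !satE !slt_real /=; lra.
by move=> [z]; rewrite !satE; exists z.
Qed.

Lemma ex_lt x : exists y, y <' x.
Proof.
og_ex (fex (flt (tvar L None) (tvar L (Some 0%N)))) (fun _ : nat => x).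
  by exists (v 0%N - 1)%R; rewrite !satE !slt_real /=; lra.
by move=> [z]; rewrite !satE; exists z.
Qed.

Lemma ex_diff x y : exists z, x = y +' z.
Proof.
og_ex (fex (feq (tvar L (Some 0%N)) (tadd (tvar L (Some 1%N)) (tvar L None))))
  (nth x [:: x; y]).
  by exists (v 0%N - v 1%N)%R; rewrite !satE sadd_real /=; lra.
by move=> [z]; rewrite !satE; exists z.
Qed.

Lemma ex_half x : exists z, x = z +' z.
Proof.
og_ex (fex (feq (tvar L (Some 0%N)) (tadd (tvar L None) (tvar L None)))) (fun _ : nat => x).
  by exists (v 0%N / 2)%R; rewrite !satE sadd_real /=; lra.
by move=> [z]; rewrite !satE; exists z.
Qed.

(** The language has no symbol for 0, so positivity is expressed as [e <' e +' e]. *)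
Lemma ex_pos : exists e, e <' e +' e.
Proof.
og_ex (fex (flt (tvar L (@None void)) (tadd (tvar L None) (tvar L None)))) (of_void M).
  by exists 1%R; rewrite !satE sadd_real slt_real /=; lra.
by move=> [z]; rewrite !satE; exists z.
Qed.

Lemma ex_half_pos e : e <' e +' e -> exists h, h <' h +' h /\ e = h +' h.
Proof.
move=> e0; have [h eh] := ex_half e; exists h; split=> //.
by move: e0; rewrite eh; og [:: h]; lra.
Qed.

Lemma ex_small_pos d e : d <' d +' d -> e <' e +' e ->
  exists h, [/\ h <' h +' h, h <' d & h <' e].
Proof.
move=> d0 e0; have [h [h0 dh]] := ex_half_pos d0; have [k [k0 ek]] := ex_half_pos e0.
have hd : h <' d by move: h0; rewrite dh; og [:: h]; lra.
have ke : k <' e by move: k0; rewrite ek; og [:: k]; lra.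
have [hk|[hk|kh]] := slt_total h k.
- by exists h; split=> //; exact: slt_trans ke.
- by exists h; split=> //; rewrite hk.
- by exists k; split=> //; exact: slt_trans hd.
Qed.

Lemma ex_pos_diff x y : x <' y -> exists d, d <' d +' d /\ y = x +' d.
Proof.
move=> xy; have [d yd] := ex_diff y x; exists d; split=> //.
by move: xy; rewrite yd; og [:: x; d]; lra.
Qed.

Lemma ex_max x y : exists z, ~ z <' x /\ ~ z <' y /\ (z = x \/ z = y).
Proof.
have irr := slt_irr; have [xy|[->|yx]] := slt_total x y.
- by exists y; split; [move=> /(slt_trans xy)/irr|split; [exact: irr|right]].
- by exists y; split; [exact: irr|split; [exact: irr|right]].
- by exists x; split; [exact: irr|split; [move=> /(slt_trans yx)/irr|left]].
Qed.

Lemma ex_min x y : exists z, ~ x <' z /\ ~ y <' z /\ (z = x \/ z = y).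
Proof.
have irr := slt_irr; have [xy|[->|yx]] := slt_total x y.
- by exists x; split; [exact: irr|split; [move=> /(slt_trans xy)/irr|left]].
- by exists y; split; [exact: irr|split; [exact: irr|right]].
- by exists y; split; [move=> /(slt_trans yx)/irr|split; [exact: irr|right]].
Qed.

Definition itv (a b x : M) := a <' x /\ x <' b.

Definition hasint (D : M -> Prop) := exists a b, a <' b /\ forall x, itv a b x -> D x.

Lemma not_hasint D : ~ hasint D -> noint S D.
Proof.
move=> H a b ab; apply: contrapT => H'; apply: H; exists a, b; split=> // x [ax xb].
by apply: contrapT => nDx; apply: H'; exists x.
Qed.

Lemma noint_hasint D : noint S D -> ~ hasint D.
Proof. by move=> H [a [b [ab K]]]; have [x [ax xb]] := H _ _ ab; apply; exact: K. Qed.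

Lemma itvI a b c d x : itv a b x -> itv c d x ->
  exists p q, itv p q x /\ forall y, itv p q y -> itv a b y /\ itv c d y.
Proof.
move=> [ax xb] [cx xd].
have [p [pa [pc Hp]]] := ex_max a c; have [q [bq [dq Hq]]] := ex_min b d.
exists p, q; split.
  by split; [case: Hp => ->|case: Hq => ->].
move=> y [py yq]; split; split.
- exact: sle_lt_trans py.
- exact: slt_le_trans bq.
- exact: sle_lt_trans py.
- exact: slt_le_trans dq.
Qed.

Lemma itv_nonempty a b x : itv a b x -> a <' b.
Proof. by move=> [ax xb]; exact: slt_trans xb. Qed.

Lemma finite_has_min (D : set M) : finite_set D -> D !=set0 ->
  exists m, D m /\ forall x, D x -> ~ x <' m.
Proof.
move=> Df; elim/finite_set_rect_prop : Df => [[]//|x B _ IH _].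
have [/IH[m [Bm mmin]]|B0] := pselect (B !=set0); last first.
  exists x; split=> [|y [->|By]]; [by left|exact: slt_irr|].
  by exfalso; apply: B0; exists y.
have [z [xz [mz zxm]]] := ex_min x m.
exists z; split; first by case: zxm => ->; [left|right].
by move=> y [->//|/mmin ym yz]; apply: mz; apply: sle_lt_trans yz.
Qed.

Lemma itv_infinite a b : a <' b -> infinite_set (itv a b).
Proof.
move=> ab fin_ab; have [|m [[am mb] mmin]] := finite_has_min fin_ab.
  by have [z [az zb]] := slt_dense ab; exists z.
have [z [az zm]] := slt_dense am.
by apply: (mmin z) => //; split=> //; exact: slt_trans mb.
Qed.

Lemma lub_unique (D : set M) s t : lub S D s -> lub S D t -> s = t.
Proof.
move=> [Ds sD] [Dt tD]; have [st|[//|ts]] := slt_total s t.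
  by have := tD _ Ds.
by have := sD _ Dt.
Qed.

(* [strip n D] is [D] without its [n] least elements. *)
Fixpoint strip n (D : M -> Prop) (x : M) : Prop :=
  if n is m.+1 then strip m D x /\ exists y, strip m D y /\ y <' x else D x.

Lemma strip_sub n D x : strip n D x -> D x.
Proof. by elim: n => [//|n IH] [/IH]. Qed.

Lemma strip_le m n D x : m <= n -> strip n D x -> strip m D x.
Proof.
elim: n m => [|n IH] m; first by rewrite leqn0 => /eqP ->.
rewrite leq_eqVlt ltnS => /predU1P[-> //|mn] [+ _]; exact: IH.
Qed.

Lemma strip_chain n D x : strip n D x ->
  exists s : seq {classic M}, [/\ uniq s, size s = n.+1 & forall y, y \in s -> D y /\ ~ x <' y].
Proof.
elim: n x => [|n IH] x.
  by move=> Dx; exists [:: x]; split=> // y; rewrite inE => /eqP ->; split=> //; exact: slt_irr.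
move=> [/strip_sub Dx [y [/IH[s [us ss Hs]] yx]]]; exists ((x : {classic M}) :: s).
split=> /=; rewrite ?us ?ss ?andbT//.
  by apply/negP => /Hs[_]; exact.
move=> z; rewrite inE => /predU1P[->|/Hs[Dz yz]]; split=> //; first exact: slt_irr.
by move=> xz; apply: yz; exact: slt_trans xz.
Qed.

(** Emptiness of [strip n D] is first-order in [D] and bounds the number of points; with
    [strip_finite] it carries finiteness from one structure to another. *)
Lemma finite_strip (D : set M) : finite_set D -> exists n, forall x, ~ strip n D x.
Proof.
move=> /(@finite_seqP {classic M})[s ->]; exists (size s) => x /strip_chain[t [ut st Ht]].
have := uniq_leq_size ut (s2 := s).
rewrite st ltnn => H; suff : false by [].
by apply: H => y /Ht[].
Qed.

Lemma strip_finite n (D : set M) : (forall x, ~ strip n D x) -> finite_set D.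
Proof.
move=> H; have : finite_set (strip n D).
  by rewrite (_ : strip n D = set0)//; apply/seteqP; split=> // x /H.
elim: n {H} => [//|n IH] /= Hf; apply: IH.
(* Stripping removes the least element if there is one and otherwise changes nothing. *)
have [[m [Dm mmin]]|D0] := pselect (exists m, strip n D m /\ forall x, strip n D x -> ~ x <' m).
  apply: (@sub_finite_set _ _ (m |` (fun x => strip n D x /\ exists y, strip n D y /\ y <' x))).
    move=> x Dx; have [xm|[->|mx]] := slt_total x m; [|by left|].
      by have := mmin _ Dx.
    by right; split=> //; exists m.
  by rewrite finite_setU; split=> //; exact: finite_set1.
apply: sub_finite_set Hf => x Dx; split=> //.
apply: contrapT => H; apply: D0; exists x; split=> // y Dy yx.
by apply: H; exists y.
Qed.

(** Each condition is inherited downwards, so the least of the witnesses serves all indices. *)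
Lemma finite_uniform (I : Type) (B : set I) (C : I -> M -> Prop) (W : M -> Prop) :
  finite_set B -> (exists t, W t) -> (forall i, B i -> exists t, W t /\ C i t) ->
  (forall i t t', C i t -> t' <' t -> C i t') ->
  exists t, W t /\ forall i, B i -> C i t.
Proof.
move=> Bf W0 + Cd; elim/finite_set_rect_prop : Bf => [_|i {}B _ IH H].
  by have [t Wt] := W0; exists t.
have [|t [Wt Ht]] := IH; first by move=> j Bj; apply: H; right.
have [|u [Wu Cu]] := H i; first by left.
have [tu|[tu|ut]] := slt_total t u.
- by exists t; split=> // j [->|]; [exact: Cd tu|exact: Ht].
- by exists t; split=> // j [->|]; [rewrite tu|exact: Ht].
- by exists u; split=> // j [->//|/Ht Cj]; exact: Cd ut.
Qed.

(** * One-variable geometry when definable sets without interior are finite *)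

Section Good.
Hypothesis gd : forall D : M -> Prop, dfn1 S setT D -> noint S D -> finite_set D.

Lemma finite_or_hasint (D : M -> Prop) : dfn1 S setT D -> ~ finite_set D -> hasint D.
Proof. by move=> dD infD; apply: contrapT => /not_hasint /(gd dD). Qed.

(** Two definable sets without interior are finite and cannot cover an interval, which is
    infinite. *)
Lemma itv_hasint_or a b (D : M -> Prop) : dfn1 S setT D -> a <' b ->
  hasint (fun x => itv a b x /\ D x) \/ hasint (fun x => itv a b x /\ ~ D x).
Proof.
move=> dD ab; have [?|H1] := pselect (hasint (fun x => itv a b x /\ D x)); first by left.
right; apply: finite_or_hasint; first by rewrite /itv; dfn_solve.
move=> fin2; have fin1 : finite_set (fun x => itv a b x /\ D x).
  by apply: contrapT => H; apply/H1/finite_or_hasint => //; rewrite /itv; dfn_solve.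
apply: (itv_infinite ab); apply: (@sub_finite_set _ _ ((fun x => itv a b x /\ D x) `|` (fun x => itv a b x /\ ~ D x))).
  by move=> x xab; have [|] := pselect (D x); [left|right].
by rewrite finite_setU.
Qed.

(* A definable function is constant on a subinterval or its image contains an interval;
   either way it stays close to one of its values on a subinterval. *)
Lemma approx_const (G : M -> M -> Prop) a b : dfn2 S setT G -> a <' b ->
  (forall x, itv a b x -> exists t, G x t) ->
  (forall x s t, G x s -> G x t -> s = t) ->
  exists x0 t0, [/\ itv a b x0, G x0 t0 & forall c d, itv c d t0 ->
    hasint (fun x => itv a b x /\ exists t, G x t /\ itv c d t)].
Proof.
move=> dG ab Gtot Gfun.
pose Im t := exists x, itv a b x /\ G x t.
have dIm : dfn1 S setT Im by rewrite /Im /itv; dfn_solve.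
have [finIm|infIm] := pselect (finite_set Im).
  have [[t [[x0 [x0ab Gx0]] inft]]|H] := pselect (exists t, Im t /\ ~ finite_set (fun x => itv a b x /\ G x t)).
    have dt : dfn1 S setT (fun x => itv a b x /\ G x t) by rewrite /itv; dfn_solve.
    have [p [q [pq Hpq]]] := finite_or_hasint dt inft.
    exists x0, t; split=> // c d cdt; exists p, q; split=> // x /Hpq[xab Gxt].
    by split=> //; exists t.
  exfalso; apply: (itv_infinite ab).
  apply: (@sub_finite_set _ _ (\bigcup_(t in Im) (fun x => itv a b x /\ G x t))).
    by move=> x xab; have [t Gxt] := Gtot _ xab; exists t => //; exists x.
  by apply: bigcup_finite => // t It; apply: contrapT => inft; apply: H; exists t.
have [p [q [pq Hpq]]] := finite_or_hasint dIm infIm.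
have [t0 t0pq] := slt_dense pq; have [x0 [x0ab Gx0]] := Hpq _ t0pq.
exists x0, t0; split=> // c d cdt.
apply: finite_or_hasint; first by rewrite /itv; dfn_solve.
move=> fin; have [p' [q' [pqt H']]] := itvI cdt t0pq.
have /choice[g Hg] : forall x, exists t, forall s, G x s -> s = t.
  move=> x; have [[t Gxt]|nG] := pselect (exists t, G x t).
    by exists t => s /Gfun; exact.
  by exists x0 => s Gxs; exfalso; apply: nG; exists s.
apply: (itv_infinite (itv_nonempty pqt)).
apply: sub_finite_set (finite_image g fin) => t /H'[cdt' /Hpq[x [xab Gxt]]].
exists x; last by rewrite -(Hg _ _ Gxt).
by split=> //; exists t.
Qed.

(** Turns pointwise witnesses into one valid on a subinterval. The supremum of [Q x] stays close to
    its value at some [x0], so an element of [W] slightly below a witness at [x0] remains below it.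
    The bound [e] makes the supremum exist. *)
Lemma uniform_bound (Q : M -> M -> Prop) (W : M -> Prop) e a b : dfn2 S setT Q ->
  (forall x t t', Q x t -> t' <' t -> Q x t') ->
  (forall x t, Q x t -> ~ e <' t) ->
  (forall t t', W t -> t <' t' -> W t') ->
  (forall t, W t -> exists t', t' <' t /\ W t') ->
  a <' b -> (forall x, itv a b x -> exists t, W t /\ Q x t) ->
  exists c p q, [/\ W c, p <' q & forall x, itv p q x -> itv a b x /\ Q x c].
Proof.
move=> dQ Qdown Qe Wup Wopen ab H.
have [|x xab|x s t|x0 [s0 [x0ab [ub0 _] Hs0]]] := @approx_const (fun x => lub S (Q x)) a b _ ab.
- by rewrite /lub; dfn_solve.
- have [t [_ Qxt]] := H _ xab.
  apply: (definably_complete SSR (A := setT)); first by dfn_solve.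
    by exists t.
  by exists e => s /Qe.
- exact: lub_unique.
have [t0 [Wt0 Qt0]] := H _ x0ab.
have [c [ct0 Wc]] := Wopen _ Wt0.
have cs0 : c <' s0 by apply: slt_le_trans ct0 (ub0 _ Qt0).
have [d s0d] := ex_gt s0.
have [p [q [pq Hpq]]] := Hs0 c d (conj cs0 s0d).
exists c, p, q; split=> // x /Hpq[xab [s [[_ ls] [cs _]]]]; split=> //.
apply: contrapT => nQ; apply: (ls c) cs => t Qxt ct.
by apply: nQ; exact: Qdown ct.
Qed.

Lemma pos_up t t' : t <' t +' t -> t <' t' -> t' <' t' +' t'.
Proof. by og [:: t; t']; lra. Qed.

Lemma pos_open t : t <' t +' t -> exists t', t' <' t /\ t' <' t' +' t'.
Proof.
move=> t0; have [h [h0 ->]] := ex_half_pos t0; exists h; split=> //.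
Qed.

(** The fibres are confined to a bounded range and then given intervals of a common length [c']. The
    supremum of the left endpoints of these intervals is nearly constant, so one point lies in the
    fibres over a whole interval. *)
Lemma fubini (Q : M -> M -> Prop) a b : dfn2 S setT Q -> a <' b ->
  (forall x, itv a b x -> hasint (Q x)) ->
  exists y, hasint (fun x => Q x y).
Proof.
move=> dQ ab HQ; have [e e0] := ex_pos.
(* The fibre contains an interval inside [(t, e - t)]; every sufficiently small [t] works, possibly
   a negative one. *)
pose Q1 x t := t <' e /\ hasint (fun y => [/\ Q x y, t <' y & y +' t <' e]).
have dQ1 : dfn2 S setT Q1.
  rewrite /Q1 /hasint /itv; apply: (@dfn_ext _ _ _ _ _ (fun v : bool -> M => v false <' e /\
    exists p q, p <' q /\ forall y, p <' y /\ y <' q -> Q (v true) y /\ v false <' y /\ y +' v false <' e)).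
    move=> v; split=> -[te [p [q [pq H]]]]; split=> //; exists p, q; split=> // y /H; first by case=> ? [].
    by case.
  by dfn_solve.
have [||||||c [a1 [b1 [_ ab1 H1]]]] := @uniform_bound Q1 (fun=> True) e a b dQ1.
- move=> x t t' [te [p [q [pq H]]]] t't; split; first exact: slt_trans te.
  exists p, q; split=> // y /H[Qxy ty yt]; split=> //; first exact: slt_trans ty.
  by move: yt t't; og [:: y; t; e; t']; lra.
- by move=> x t [te _] /(slt_trans te) /slt_irr.
- by [].
- by move=> t _; have [t' t't] := ex_lt t; exists t'.
- exact: ab.
- move=> x /HQ[p [q [pq H]]].
  have [z ez] := ex_diff e q; have [m [pm [zm _]]] := ex_min p z.
  have [n [mn [en _]]] := ex_min m e; have [t tn] := ex_lt n.
  have te : t <' e by apply: slt_le_trans tn en.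
  have tm : t <' m by apply: slt_le_trans tn mn.
  exists t; split=> //; split=> //; exists p, q; split=> // y yI; split; first exact: H.
    by apply: slt_trans (proj1 yI); exact: slt_le_trans pm.
  have tz : t <' z by exact: slt_le_trans zm.
  by move: tz (proj2 yI); rewrite ez; og [:: t; z; y; q]; lra.
pose Q' x y := [/\ Q x y, c <' y & y +' c <' e].
pose Q2 x t := t <' e /\ exists g, forall y, itv g (g +' t) y -> Q' x y.
(* [dfn_solve] treats binary conjunctions only, hence this variant of [Q2]. *)
pose Q2' x t := t <' e /\ exists g, forall y, itv g (g +' t) y -> Q x y /\ c <' y /\ y +' c <' e.
have Q2E x t : Q2 x t <-> Q2' x t.
  by split=> -[te [g H]]; split=> //; exists g => y /H; [case|case=> ? []].
have dQ2 : dfn2 S setT Q2.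
  apply: (@dfn_ext _ _ _ _ _ (fun v : bool -> M => Q2' (v true) (v false))) => [v|]; first by rewrite Q2E.
  by rewrite /Q2' /itv; dfn_solve.
have [||||||c' [a2 [b2 [c'0 ab2 H2]]]] := @uniform_bound Q2 (fun t => t <' t +' t) e a1 b1 dQ2.
- move=> x t t' [te [g H]] t't; split; first exact: slt_trans te.
  exists g => y [gy yg]; apply: H; split=> //.
  by move: yg t't; og [:: y; g; t'; t]; lra.
- by move=> x t [te _] /(slt_trans te) /slt_irr.
- exact: pos_up.
- exact: pos_open.
- exact: ab1.
- move=> x /H1[xab [_ [p [q [pq H]]]]].
  have [d [d0 qd]] := ex_pos_diff pq; have [h [h0 hd he]] := ex_small_pos d0 e0.
  exists h; split=> //; split=> //; exists p => y [py yh]; apply: H; split=> //.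
  by rewrite qd; move: yh hd; og [:: y; p; h; d]; lra.
have [|x xab|x s t|x0 [s0 [x0ab _ Hs0]]] := @approx_const
    (fun x => lub S (fun g => forall y, itv g (g +' c') y -> Q' x y)) a2 b2 _ ab2.
- rewrite /lub; apply: (@dfn_ext _ _ _ _ _ (fun v : bool -> M =>
    lub S (fun g => forall y, itv g (g +' c') y -> Q (v true) y /\ c <' y /\ y +' c <' e) (v false))).
    move=> v; rewrite (_ : (fun g => _) = (fun g => forall y, itv g (g +' c') y -> Q' (v true) y))//.
    by apply/funext => g; apply: eq_forall => y; rewrite /Q' propeqE; split=> H /H; [case=> ? []|case].
  by rewrite /lub /itv; dfn_solve.
- have [_ [_ [g Hg]]] := H2 _ xab.
  have gc g' : g' <' g' +' c' by move: c'0; og [:: g'; c']; lra.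
  have [z ez] := ex_diff e c.
  apply: (definably_complete SSR (A := setT)).
  + apply: (@dfn_ext _ _ _ _ _ (fun v : unit -> M => forall y, itv (v tt) (v tt +' c') y ->
       Q x y /\ c <' y /\ y +' c <' e)).
      by move=> v; split=> H y /H; [case=> ? []|case].
    by rewrite /itv; dfn_solve.
  + by exists g.
  + exists z => g' H; have [y [g'y yg']] := slt_dense (gc g').
    have [_ _] := H _ (conj g'y yg').
    by move: g'y; rewrite ez; og [:: g'; y; c; z]; lra.
- exact: lub_unique.
(* [l] is a quarter of [c']: an interval of length [c'] whose left endpoint is within [l] of [s0]
   contains [s0 +' l]. *)
have [k [k0 ck]] := ex_half_pos c'0; have [l [l0 kl]] := ex_half_pos k0.
have [w0 s0w] := ex_diff s0 l.
have w0s : w0 <' s0 by move: l0; rewrite s0w; og [:: l; w0]; lra.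
have sw1 : s0 <' s0 +' l by move: l0; og [:: l; s0]; lra.
have [p [q [pq Hpq]]] := Hs0 _ _ (conj w0s sw1).
exists (s0 +' l), p, q; split=> // x /Hpq[xab [s [[ubs ls] [ws sw]]]].
have [g [Hg w0g]] : exists g, (forall y, itv g (g +' c') y -> Q' x y) /\ w0 <' g.
  apply: contrapT => H; apply: (ls w0) ws => g Hg w0g.
  by apply: H; exists g.
have [] // := Hg (s0 +' l); split.
  by apply: sle_lt_trans sw; exact: ubs.
by move: w0g l0; rewrite ck kl s0w; og [:: w0; g; l]; lra.
Qed.

(** * Stability of finite fibres *)

Definition near (e y y' : M) := y <' y' +' e /\ y' <' y +' e.

(** Gaps are at least [2e], so moving every point by less than [e] keeps the order. *)
Definition spaced (e : M) (D : M -> Prop) :=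
  forall y z, D y -> D z -> y <' z -> ~ z <' y +' e +' e.

(* The fibres over an interval around [a] correspond to each other by moving points less
   than half of the minimal gap, so this is a definable form of "the fibres over a
   neighbourhood of [a] have the same number of points". *)
Definition stable_at (F : M -> M -> Prop) (a : M) :=
  exists p q e, itv p q a /\ e <' e +' e /\
    (forall x, itv p q x -> spaced e (F x)) /\
    forall x x' y, itv p q x -> itv p q x' -> F x y -> exists y', F x' y' /\ near e y y'.

(** The matching is increasing on [F], so points of [F] below [y] yield points of [F'] below
    [y']. *)
Lemma strip_near F F' e n y y' : spaced e F ->
  (forall z, F z -> exists z', F' z' /\ near e z z') ->
  F' y' -> near e y y' -> strip n F y -> strip n F' y'.
Proof.
move=> spF mF F'y' yy'; elim: n y y' F'y' yy' => [//|n IH] y y' F'y' yy'.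
move=> [ny [z [nz zy]]]; split; first exact: IH yy' ny.
have [z' [F'z' zz']] := mF _ (strip_sub nz).
exists z'; split; first exact: IH zz' nz.
have := spF _ _ (strip_sub nz) (strip_sub ny) zy.
by case: yy' zz' => + + [+ +]; og [:: y; y'; z; z'; e]; lra.
Qed.

Lemma stable_at_strip F a n : stable_at F a -> exists p q, itv p q a /\
  forall x x', itv p q x -> itv p q x' ->
    (exists y, strip n (F x) y) -> exists y, strip n (F x') y.
Proof.
move=> [p [q [e [apq [_ [sp mt]]]]]]; exists p, q; split=> // x x' xpq x'pq [y ny].
have [y' [F'y' yy']] := mt _ _ _ xpq x'pq (strip_sub ny).
exists y'; apply: (strip_near (e := e)) yy' ny => //; first exact: sp.
by move=> z; exact: mt.
Qed.

(** Otherwise, near every point of the interval, some fibre has a point without close counterpart in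
    another fibre. On a subinterval with uniform gaps and bounds, the lower limit of these bad
    points is nearly constant, so bad points occur in one window narrower than [eps] over every
    smaller interval. On some interval either all fibres meet the window or none does, and a bad
    point there contradicts both. *)
Lemma stable_dense F a b : dfn2 S setT F -> (forall x, finite_set (F x)) -> a <' b ->
  exists x, itv a b x /\ stable_at F x.
Proof.
move=> dF finF ab; have [e e0] := ex_pos; apply: contrapT => nst.
have [|||||||eps [a1 [b1 [eps0 ab1 H1]]]] := @uniform_bound
    (fun x t => t <' e /\ spaced t (F x)) (fun t => t <' t +' t) e a b.
- by rewrite /spaced; dfn_solve.
- move=> x t t' [te sp] t't; split; first exact: slt_trans te.
  move=> y z Fy Fz yz; move: (sp _ _ Fy Fz yz) t't.
  by og [:: y; z; t; t']; lra.
- by move=> x t [te _] /(slt_trans te) /slt_irr.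
- exact: pos_up.
- exact: pos_open.
- exact: ab.
- move=> x _.
  have [||||t [t0 Ht]] := @finite_uniform _ (F x `*` F x)
     (fun yz t => yz.1 <' yz.2 -> ~ yz.2 <' yz.1 +' t +' t) (fun t => t <' t +' t).
  + exact: finite_setX.
  + by exists e.
  + move=> [y z] _ /=; have [/ex_pos_diff[d [d0 ->]]|nyz] := pselect (y <' z); last by exists e.
    have [h [h0 ->]] := ex_half_pos d0; exists h; split=> // _.
    by og [:: y; h]; lra.
  + move=> [y z] t t' /= H t't yz; move: (H yz) t't.
    by og [:: y; z; t; t']; lra.
  have [h [h0 ht he]] := ex_small_pos t0 e0.
  exists h; split=> //; split=> // y z Fy Fz yz.
  by move: (Ht (y, z) (conj Fy Fz) yz) ht => /=; og [:: y; z; t; h]; lra.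
have [|||||||c [a2 [b2 [_ ab2 H2]]]] := @uniform_bound
    (fun x t => t <' e /\ forall y, F x y -> t <' y /\ y +' t <' e) (fun=> True) e a1 b1.
- by dfn_solve.
- move=> x t t' [te bd] t't; split; first exact: slt_trans te.
  move=> y /bd[ty yt]; split; first exact: slt_trans ty.
  by move: yt t't; og [:: y; t; e; t']; lra.
- by move=> x t [te _] /(slt_trans te) /slt_irr.
- by [].
- by move=> t _; have [t' t't] := ex_lt t; exists t'.
- exact: ab1.
- move=> x _.
  have [||||t [_ Ht]] := @finite_uniform _ (F x) (fun y t => t <' y /\ y +' t <' e) (fun=> True).
  + exact: finF.
  + by exists e.
  + move=> y _; have [z ez] := ex_diff e y.
    have [m [ym [zm _]]] := ex_min y z; have [t tm] := ex_lt m.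
    exists t; split=> //; split; first exact: slt_le_trans tm ym.
    have tz : t <' z by exact: slt_le_trans tm zm.
    by move: tz; rewrite ez; og [:: t; z; y]; lra.
  + move=> y t t' [ty yt] t't; split; first exact: slt_trans ty.
    by move: yt t't; og [:: y; t; e; t']; lra.
  have [m [tm [em _]]] := ex_min t e; have [u um] := ex_lt m.
  exists u; split=> //; split; first exact: slt_le_trans um em.
  have ut : u <' t by exact: slt_le_trans um tm.
  move=> y /Ht[ty yt]; split; first exact: slt_trans ty.
  by move: yt ut; og [:: y; t; e; u]; lra.
(* A fibre over [(u1, u2)] contains [y], while another has no point within [eps] of it. *)
pose bad u1 u2 y := exists x x', (itv u1 u2 x /\ itv a2 b2 x) /\
  (itv u1 u2 x' /\ itv a2 b2 x') /\ F x y /\ forall y', F x' y' -> ~ near eps y y'.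
have bad_ex u1 u2 x : itv u1 u2 x -> itv a2 b2 x -> exists y, bad u1 u2 y.
  move=> xu x2; have [p [q [xpq Hpq]]] := itvI xu x2.
  apply: contrapT => nbad; apply: nst; exists x.
  have [x1 _] := H2 _ x2; split; first by have [] := H1 _ x1.
  exists p, q, eps; split=> //; split=> //; split.
    by move=> z /Hpq[_ /H2[/H1[_ []]]].
  move=> z z' y zpq z'pq Fzy; apply: contrapT => nnear; apply: nbad; exists y, z, z'.
  split; first exact: Hpq.
  split; first exact: Hpq.
  by split=> // y' Fy' yy'; apply: nnear; exists y'.
(* The supremum of [low x] is the lower limit of the bad points over shrinking neighbourhoods of
   [x]. *)
pose low x s := exists u1 u2, itv u1 u2 x /\ forall y, bad u1 u2 y -> ~ y <' s.
have dlow : dfn2 S setT low by rewrite /low /bad /itv /near; dfn_solve.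
have [z ez] := ex_diff e c.
have bad_bd u1 u2 y : bad u1 u2 y -> c <' y /\ y <' z.
  move=> [x [x' [[_ /H2[_ [_ H]]] [_ [/H[cy ye] _]]]]]; split=> //.
  by move: ye; rewrite ez; og [:: y; c; z]; lra.
have [|x xab|x s t|x0 [b0 [x0ab _ Hb0]]] := @approx_const (fun x => lub S (low x)) a2 b2 _ ab2.
- by rewrite /lub; dfn_solve.
- apply: (definably_complete SSR (A := setT)); first by dfn_solve.
    exists c, a2, b2; split=> // y /bad_bd[cy _] /(slt_trans cy); exact: slt_irr.
  exists z => s [u1 [u2 [xu Hs]]] zs.
  have [y ybad] := bad_ex _ _ _ xu xab.
  by apply: (Hs _ ybad); apply: slt_trans zs; have [] := bad_bd _ _ _ ybad.
- exact: lub_unique.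
(* [l] is a quarter of [eps], so any two points of the window [(w0, b0 +' l)] are [eps]-near. *)
have [k [k0 ek]] := ex_half_pos eps0; have [l [l0 kl]] := ex_half_pos k0.
have [w0 b0w] := ex_diff b0 l.
have w0b : w0 <' b0 by move: l0; rewrite b0w; og [:: l; w0]; lra.
have bw1 : b0 <' b0 +' l by move: l0; og [:: l; b0]; lra.
have near_w y y' : itv w0 (b0 +' l) y -> itv w0 (b0 +' l) y' -> near eps y y'.
  by move=> [+ +] [+ +]; rewrite /near ek kl b0w; move: l0; og [:: y; y'; w0; l]; lra.
have [a3 [b3 [ab3 H3]]] := Hb0 _ _ (conj w0b bw1).
(* Over a small neighbourhood all bad points are at least some [s] above [w0], and one of them is
   below [r], because [r] exceeds the lower limit. *)
have bad_near x u1 u2 : itv a3 b3 x -> itv u1 u2 x -> exists y, bad u1 u2 y /\ itv w0 (b0 +' l) y.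
  move=> /H3[x2 [t [[ubt lt] [wt tw]]]] xu.
  have [s [[v1 [v2 [xv Hs]]] ws]] : exists s, low x s /\ w0 <' s.
    apply: contrapT => H; apply: (lt w0) wt => s sl ws.
    by apply: H; exists s.
  have [r [tr rw]] := slt_dense tw.
  have [p [q [xpq Hpq]]] := itvI xu xv.
  have bad_sub y : bad p q y -> bad u1 u2 y /\ bad v1 v2 y.
    move=> [x1 [x2' [[/Hpq[? ?] ?] [[/Hpq[? ?] ?] ?]]]].
    by split; exists x1, x2'.
  have [y [/bad_sub[yu yv] yr]] : exists y, bad p q y /\ y <' r.
    apply: contrapT => H; apply: (ubt r) tr; exists p, q; split=> // y yb yr.
    by apply: H; exists y.
  exists y; split=> //; split; last exact: slt_trans rw.
  by apply: slt_le_trans ws _; exact: Hs.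
have dmeet : dfn1 S setT (fun x => exists y, F x y /\ itv w0 (b0 +' l) y).
  by rewrite /itv; dfn_solve.
have [[p [q [pq Hpq]]]|[p [q [pq Hpq]]]] := itv_hasint_or dmeet ab3;
  have [x xpq] := slt_dense pq; have [x3 _] := Hpq _ xpq;
  have [y [[x1 [x2 [[x1pq _] [[x2pq _] [Fy ny]]]]] yw]] := bad_near _ _ _ x3 xpq.
- have [_ [y' [Fy' y'w]]] := Hpq _ x2pq.
  by apply: (ny _ Fy'); exact: near_w.
- by have [_] := Hpq _ x1pq; apply; exists y.
Qed.

(** Definable connectedness: the set of [t] such that [B] holds on [[x, t]] has a supremum, and
    local constancy there rules out that it stops before [x']. *)
Lemma locally_constant_itv (B : M -> Prop) x x' : dfn1 S setT B -> x <' x' ->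
  (forall s, ~ s <' x -> ~ x' <' s -> exists p q, itv p q s /\
     forall u w, itv p q u -> itv p q w -> B u -> B w) ->
  B x -> B x'.
Proof.
move=> dB xx' loc Bx.
pose T t := ~ t <' x /\ ~ x' <' t /\ forall u, ~ u <' x -> ~ t <' u -> B u.
have Tx : T x.
  split; first exact: slt_irr; split; first by move=> /(slt_trans xx')/slt_irr.
  by move=> u ux xu; have [|[->|]] := slt_total u x.
have [|||s [ubs ls]] := definably_complete SSR (A := setT) (D := T).
- by rewrite /T; dfn_solve.
- by exists x.
- by exists x' => t [_ []].
have sx : ~ s <' x := ubs _ Tx.
have x's : ~ x' <' s by apply: ls => t [_ []].
have [p [q [[ps sq] Bpq]]] := loc _ sx x's.
have [t [[tx [x't Bt]] pt]] : exists t, T t /\ p <' t.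
  apply: contrapT => H; apply: (ls p) ps => t Tt pt.
  by apply: H; exists t.
have st : ~ s <' t := ubs _ (conj tx (conj x't Bt)).
have tpq : itv p q t by split=> //; exact: sle_lt_trans sq.
have Bu u : ~ u <' x -> u <' q -> B u.
  move=> ux uq; have [|nt] := pselect (t <' u); last exact: Bt.
  move=> tu; apply: (Bpq t) => //; first by split=> //; exact: slt_trans tu.
  by apply: Bt => //; exact: slt_irr.
have [sx'|[<-|//]] := slt_total s x'; last exact: (Bu s sx sq).
have [m [qm [x'm mqx]]] := ex_min q x'.
have sm : s <' m by case: mqx => ->.
have [r [sr rm]] := slt_dense sm.
exfalso; apply: (ubs r) (sr); split; [|split].
- by move=> rx; apply: sx; exact: slt_trans rx.
- by move=> x'r; apply: x'm; exact: slt_trans rm.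
- move=> u ux ru; apply: Bu => //; apply: sle_lt_trans ru _.
  exact: slt_le_trans rm qm.
Qed.

Lemma sub_count_eq (T : Type) (a1 a2 : pred T) (s : seq T) :
  (forall x, a1 x -> a2 x) -> count a1 s = count a2 s ->
  forall x : {classic T}, x \in (s : seq {classic T}) -> a2 x -> a1 x.
Proof.
move=> sub; elim: s => [//|y s IH] /= eqc x; have le_s := sub_count sub s.
have [a1y|/negP na1y] := boolP (a1 y).
  move: eqc; rewrite a1y (sub _ a1y) => /addnI/IH{}IH.
  by rewrite inE => /predU1P[->|/IH].
have na2y : a2 y = false.
  apply/negP => a2y; move: eqc le_s; rewrite (negPf (introN idP na1y)) a2y add0n => ->.
  by rewrite add1n ltnn.
move: eqc; rewrite na2y (negPf (introN idP na1y)) => /IH{}IH.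
by rewrite inE => /predU1P[->|/IH//]; rewrite na2y.
Qed.

Lemma dfn_strip (F : M -> M -> Prop) n : dfn2 S setT F ->
  dfn2 S setT (fun x => strip n (F x)).
Proof.
have step Q : dfn2 S setT Q -> dfn2 S setT (fun x y => Q x y /\ exists z, Q x z /\ z <' y).
  by move=> dQ; dfn_solve.
by move=> dF; elim: n => [//|n IH]; exact: (step (fun x => strip n (F x))).
Qed.

(** Unstable points form a definable set without interior, hence a finite one. Between consecutive
    unstable points, whether a fibre has more than [n] points does not change, so one bound per
    component suffices. *)
Lemma uniform_finiteness F : dfn2 S setT F -> (forall x, finite_set (F x)) ->
  exists n, forall x y, ~ strip n (F x) y.
Proof.
move=> dF finF.
have [s Hs] : exists s : seq {classic M}, ~` stable_at F = [set` s].
  apply/finite_seqP; apply: gd.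
    rewrite /stable_at /itv /spaced /near /setC /mkset; dfn_solve.
  move=> a b ab; have [x [[ax xb] st]] := stable_dense dF finF ab.
  by exists x; split=> //; exact.
have {}Hs x : x \in s \/ stable_at F x.
  have [st|nst] := pselect (stable_at F x); [by right|left].
  by have : (~` stable_at F) x by []; rewrite Hs.
have /choice[N HN] : forall x, exists n, forall y, ~ strip n (F x) y.
  by move=> x; exact: finite_strip.
(* The number of unstable points below [x] names the component of a stable [x]. *)
pose cnt x := count (fun f : M => `[< f <' x >]) s.
have cntE n x x' : stable_at F x -> stable_at F x' -> cnt x = cnt x' -> x <' x' ->
    (exists y, strip n (F x) y) <-> (exists y, strip n (F x') y).
  move=> stx stx' cxx' xx'.
  have st w : ~ w <' x -> ~ x' <' w -> stable_at F w.
    move=> wx x'w; have [ws|//] := Hs w.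
    have [xw|[<-//|//]] := slt_total x w; have [wx'|[->//|//]] := slt_total w x'.
    exfalso; apply: (wx); apply/asboolP; move: (w) ws {wx x'w xw} (asboolT wx').
    apply: sub_count_eq cxx' => f /asboolP fx; apply/asboolP; exact: slt_trans xx'.
  have loc w : ~ w <' x -> ~ x' <' w -> exists p q, itv p q w /\ forall u v,
      itv p q u -> itv p q v -> (exists y, strip n (F u) y) <-> exists y, strip n (F v) y.
    move=> wx x'w; have [p [q [wpq H]]] := stable_at_strip n (st _ wx x'w).
    by exists p, q; split=> // u v up vp; split; exact: H.
  have dex Q : dfn2 S setT Q -> dfn1 S setT (fun x => exists y, Q x y) by move=> dQ; dfn_solve.
  have dD : dfn1 S setT (fun x => exists y, strip n (F x) y) by exact: (dex _ (dfn_strip n dF)).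
  split.
    apply: (@locally_constant_itv (fun x => exists y, strip n (F x) y)) => //.
    move=> w wx x'w; have [p [q [wpq H]]] := loc _ wx x'w.
    by exists p, q; split=> // u v up vp; rewrite (H u v).
  apply: contraPP; apply: (@locally_constant_itv (fun x => ~ exists y, strip n (F x) y)) => //.
    exact: dfn_not.
  move=> w wx x'w; have [p [q [wpq H]]] := loc _ wx x'w.
  by exists p, q; split=> // u v up vp; rewrite (H u v).
have /choice[K HK] : forall k, exists n, forall x, stable_at F x -> cnt x = k -> forall y, ~ strip n (F x) y.
  move=> k; have [[x [stx cx]]|H] := pselect (exists x, stable_at F x /\ cnt x = k); last first.
    by exists 0 => x stx cx; exfalso; apply: H; exists x.
  exists (N x) => x' stx' cx' y Hy.
  suff [z] : exists z, strip (N x) (F x) z by exact: HN.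
  have [xx'|[xE|x'x]] := slt_total x x'; last 2 first.
  - by move: Hy; rewrite -xE; exists y.
  - by apply/(cntE _ _ _ stx' stx) => //; [rewrite cx cx'|exists y].
  - by apply/(cntE _ _ _ stx stx') => //; [rewrite cx cx'|exists y].
exists (maxn (\max_(f <- s) N f) (\max_(k < (size s).+1) K k)) => x y Hy.
have [xs|stx] := Hs x.
  apply: (HN x y); apply: strip_le Hy; rewrite leq_max; apply/orP; left.
  exact: (@leq_bigmax_seq {classic M} s xpredT N x xs isT).
apply: (HK (cnt x) x stx erefl y); apply: strip_le Hy; rewrite leq_max; apply/orP; right.
have cs : cnt x < (size s).+1 by rewrite ltnS count_size.
exact: (@leq_bigmax _ (fun k : 'I_(size s).+1 => K k) (Ordinal cs)).
Qed.

End Good.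
End OMinimal.

(** * Uniform finiteness *)

Section Formulas.
Variable L' : language.
Let L := lang_sum ogroup_lang L'.

(** [fnoint] and [fstrip] internalize [noint] and [strip], so that these can be quantified over the
    parameters and transferred. *)
Definition fnoint V (phi : formula L (option V)) : formula L V :=
  fall (fall (fimp (flt (tvar L (Some None)) (tvar L None))
    (fex (fand (fand (flt (tvar L (Some (Some None))) (tvar L None))
                     (flt (tvar L None) (tvar L (Some None))))
               (fneg (frename (omap (Some \o Some)) phi)))))).

Lemma sat_noint M (S : structure L M) V (phi : formula L (option V)) v :
  sat S (fnoint phi) v = noint S (fun x => sat S phi (oapp v x)).
Proof.
rewrite /fnoint sat_all; apply: eq_forall => a; rewrite sat_all; apply: eq_forall => b.
rewrite sat_imp sat_lt sat_ex; congr (_ -> _); apply: eq_exists => x.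
rewrite !satE sat_rename (_ : _ \o _ = oapp v x); last by apply/funext => -[].
by rewrite propeqE; split=> [[[]]|[]].
Qed.

Fixpoint fstrip n V (phi : formula L (option V)) : formula L (option V) :=
  if n is m.+1 then
    fand (fstrip m phi) (fex (fand (frename (omap Some) (fstrip m phi))
                                  (flt (tvar L None) (tvar L (Some None)))))
  else phi.

Lemma sat_strip M (S : structure L M) n V (phi : formula L (option V)) v x :
  sat S (fstrip n phi) (oapp v x) = strip S n (fun y => sat S phi (oapp v y)) x.
Proof.
elim: n x => [//|n IH] x; rewrite [RHS]/= /fstrip -/fstrip sat_and IH sat_ex; congr (_ /\ _).
apply: eq_exists => y; rewrite !satE sat_rename -IH (_ : _ \o _ = oapp v y)//.
by apply/funext => -[].
Qed.

End Formulas.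

Section UniformFiniteness.
Variables (R : realType) (L' : language) (E : structure L' R).
Let L := lang_sum ogroup_lang L'.
Let SR : structure L R := struct_sum (ogroup_struct R) E.
Hypothesis omin : o_minimal SR.
Variables (M : Type) (S : structure L M).
Hypothesis SSR : theory_of S = theory_of SR.

Local Notation "x <' y" := (slt S x y) (at level 70).
Local Notation "x +' y" := (sadd S x y) (at level 50, left associativity).

Ltac og l := og_with SSR l.

Definition good (A : set M) :=
  forall D : M -> Prop, dfn1 S A D -> noint S D -> finite_set D.

(** A set definable over [e] has a counterpart in the reals, defined with 1 in place of [e]; the
    bound on its number of points transfers back. *)
Lemma good_type (e : M) :
  (forall phi : formula L unit, sat SR phi (fun=> 1%R) -> sat S phi (fun=> e)) ->
  good [set e].
Proof.
move=> He D [psi Dpsi] niD.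
have {He}He (phi : formula L unit) : sat S phi (fun=> e) = sat SR phi (fun=> 1%R).
  rewrite propeqE; split; last exact: He.
  by apply: contraPP => H; exact: (He (fneg phi)).
pose phi : formula L (option unit) :=
  frename (fun z : unit + [set e] => if z is inr _ then Some tt else None) psi.
have Dphi : D = (fun x => sat S phi (oapp (fun=> e) x)).
  apply/funext => x; rewrite (Dpsi (fun=> x)) sat_rename; congr sat.
  by apply/funext => -[//|a] /=; exact: (set_mem (valP a)).
have : noint SR (fun x => sat SR phi (oapp (fun=> 1%R) x)).
  by rewrite -sat_noint -He sat_noint -Dphi.
move=> /(real_noint_finite omin)/(finite_strip (erefl (theory_of SR)))[n Hn].
apply: (strip_finite SSR (n := n)).
have : sat S (fall (fneg (fstrip n phi))) (fun=> e).
  by rewrite He sat_all => x; rewrite sat_neg sat_strip.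
by rewrite sat_all Dphi => H x; have := H x; rewrite sat_neg sat_strip.
Qed.

(** * Definable choice *)

Section Skolem.
Variables (A : set M) (e : M).
Hypotheses (clA : forall x, dcl S A x -> A x) (Ae : A e) (e0 : e <' e +' e).

(** Let [i] be the infimum of the part of [D] above [e]. If [i] is not in [D], then [D] contains an
    interval starting at [i], and the point chosen is the midpoint of the longest one, with length
    cut off at [e] for the supremum to exist. *)
Lemma skolem_right D : dfn1 S A D -> ~ D e -> (exists x, e <' x /\ D x) ->
  exists x, A x /\ D x.
Proof.
move=> dD nDe [x0 [ex0 Dx0]].
pose T t := forall x, e <' x -> D x -> ~ x <' t.
have dT : dfn1 S A T by rewrite /T; dfn_solve.
have [||i lubi] := definably_complete SSR dT.
- by exists e => x ex _ /(slt_trans SSR ex)/(slt_irr SSR).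
- by exists x0 => t; exact.
have Ai : A i.
  apply: clA; apply: (@dfn_ext _ _ _ _ _ (fun v : unit -> M => lub S T (v tt))).
    by move=> v; split=> [/(lub_unique SSR)/(_ lubi)|->].
  by rewrite /lub; dfn_solve.
have [Di|nDi] := pselect (D i); first by exists i.
have [ubi li] := lubi.
have [j [ij [Dij|nDij]]] := right_const omin SSR i dD; last first.
  exfalso; apply: (ubi j) ij => x ex Dx xj.
  have [xi|[xi|ix]] := slt_total SSR x i.
  - by apply: (li x) xi => t; exact.
  - by apply: nDi; rewrite -xi.
  - exact: (nDij x).
have [d [d0 jd]] := ex_pos_diff SSR ij.
pose W h := ~ e <' h /\ forall x, i <' x -> x <' i +' h -> D x.
have dW : dfn1 S A W by rewrite /W; dfn_solve.
have [h [h0 hd he]] := ex_small_pos SSR d0 e0.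
have Wh : W h.
  split=> [/(slt_trans SSR he)|x ix xh]; first exact: (slt_irr SSR).
  by apply: Dij => //; rewrite jd; move: xh hd; og [:: x; i; h; d]; lra.
have [||w lubw] := definably_complete SSR dW.
- by exists h.
- by exists e => t [].
have [ubw lw] := lubw.
have Aw : A w.
  apply: clA; apply: (@dfn_ext _ _ _ _ _ (fun v : unit -> M => lub S W (v tt))).
    by move=> v; split=> [/(lub_unique SSR)/(_ lubw)|->].
  by rewrite /lub; dfn_solve.
have [k wk] := ex_half SSR w.
have k0 : k <' k +' k.
  by have := ubw _ Wh; rewrite wk; move: h0; og [:: h; k]; lra.
have Ak : A k.
  apply: clA; apply: (@dfn_ext _ _ _ _ _ (fun v : unit -> M => v tt +' v tt = w)).
    by move=> v; split=> [|->//]; rewrite wk; og [:: v tt; k]; lra.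
  by dfn_solve.
exists (i +' k); split.
  by apply: clA; rewrite /dcl; dfn_solve.
have [t [[_ Dt] kt]] : exists t, W t /\ k <' t.
  apply: contrapT => H; apply: (lw k); last by rewrite wk.
  by move=> t Wt kt; apply: H; exists t.
by apply: Dt; [move: k0; og [:: k; i]; lra|move: kt; og [:: k; t; i]; lra].
Qed.

Lemma skolem D : dfn1 S A D -> (exists x, D x) -> exists x, A x /\ D x.
Proof.
move=> dD [x Dx]; have [De|nDe] := pselect (D e); first by exists e.
have [xe|[xe|ex]] := slt_total SSR x e; [|by rewrite -xe in nDe|]; last first.
  by apply: skolem_right => //; exists x.
(* The reflection about [e] reduces to a set with points above [e]. *)
pose D' y := exists x, D x /\ x +' y = e +' e.
have [|||y [Ay [z [Dz zye]]]] := @skolem_right D'.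
- by rewrite /D'; dfn_solve.
- move=> [y [Dy ye]]; suff : y = e by move=> yE; rewrite yE in Dy.
  by move: ye; og [:: y; e]; lra.
- have [y ey] := ex_diff SSR (e +' e) x; exists y; split.
    by move: xe ey; og [:: x; e; y]; lra.
  by exists x.
exists z; split=> //; apply: clA.
apply: (@dfn_ext _ _ _ _ _ (fun v : unit -> M => v tt +' y = e +' e)).
  by move=> v; split=> [|->//]; move: zye; og [:: z; y; e; v tt]; lra.
by dfn_solve.
Qed.

End Skolem.

Lemma good_adjoin (A : set M) (e b : M) :
  (forall x, dcl S A x -> A x) -> A e -> e <' e +' e -> good A -> good (b |` A).
Proof.
move=> clA Ae e0 gA D.
have [|SA satA] := tarski_vaught (S := S) (A := A).
  by move=> X dX X0; exact: (skolem clA Ae e0).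
have SASR : theory_of SA = theory_of SR.
  rewrite -SSR; apply/seteqP; split=> phi; rewrite /theory_of/= satA;
  by rewrite (_ : (fun i : void => _) = of_void M)//; apply/funext => -[].
have sltA x y : slt SA x y = slt S (\val x) (\val y).
  have := satA _ (flt (tvar L true) (tvar L false)) (fun b => if b then x else y).
  by rewrite !sat_lt.
(* The formula of [X], with its parameters from [A], defines in [M] a set without interior, to which
   [gA] applies. *)
have gdA (X : A -> Prop) : dfn1 SA setT X -> noint SA X -> finite_set X.
  move=> [phi Hphi] niX.
  pose c (z : unit + [set: A]) : option A := if z is inr a then Some (\val a) else None.
  have HX x : X x = sat SA (frename c phi) (oapp id x).
    rewrite (Hphi (fun=> x)) sat_rename; congr sat.
    by apply/funext => -[].
  have : finite_set (fun x => sat S (frename c phi) (oapp (fun a : A => \val a) x)).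
    apply: gA; first by apply/definable_overE; exists (frename c phi).
    rewrite -sat_noint -(satA _ _ id) sat_noint.
    by rewrite (_ : (fun x => _) = X)//; apply/funext => x; rewrite HX.
  move=> fin; apply: (@sub_finite_set _ _ ((fun a : A => \val a) @^-1` _) _ (finite_preimage _ fin)).
    move=> x; rewrite HX satA /preimage /=.
    by rewrite (_ : (fun i => _) = oapp (fun a : A => \val a) (\val x))//; apply/funext => -[].
  by move=> x y _ _; exact: val_inj.
move=> dD niD; have [Y [psi HY] DY] := dfn_addE dD.
pose c (z : option unit + A) : option (option A) :=
  match z with inl (Some _) => None | inl None => Some None | inr a => Some (Some a) end.
pose phi := frename c psi.
have Dphi x : D x = sat S phi (oapp (oapp (fun a : A => \val a) b) x).
  rewrite (_ : D x = Y (oapp (fun=> x) b)); last by rewrite -(DY (fun=> x)).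
  by rewrite HY sat_rename; congr sat; apply/funext => -[[]|].
(* Fibres with interior are emptied, so that every fibre of [F] is finite. *)
pose theta := fand phi (frename Some (fnoint phi)).
have theta_phi N (S' : structure L N) w x : sat S' theta (oapp w x) =
    (sat S' phi (oapp w x) /\ noint S' (fun y => sat S' phi (oapp w y))).
  by rewrite sat_and (sat_rename _ (fnoint phi)) sat_noint.
pose F y x := sat SA theta (oapp (oapp id y) x).
have dphi (chi : formula L (option (option A))) y : dfn1 SA setT (fun x => sat SA chi (oapp (oapp id y) x)).
  pose c' (o : option (option A)) : unit + [set: A] := match o with
    | None => inl tt | Some None => inr (SigSub (mem_set (I : [set: A] y)))
    | Some (Some a) => inr (SigSub (mem_set (I : [set: A] a))) end.
  exists (frename c' chi) => v; rewrite sat_rename; congr sat.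
  by apply/funext => -[[]|].
have dF : dfn2 SA setT F.
  pose c' (o : option (option A)) : bool + [set: A] := match o with
    | None => inl false | Some None => inl true
    | Some (Some a) => inr (SigSub (mem_set (I : [set: A] a))) end.
  exists (frename c' theta) => v; rewrite sat_rename; congr sat.
  by apply/funext => -[[]|].
have finF y : finite_set (F y).
  have [ni|hi] := pselect (noint SA (fun x => sat SA phi (oapp (oapp id y) x))).
    apply: sub_finite_set (gdA _ (dphi phi y) ni) => x.
    by rewrite /F theta_phi => -[].
  rewrite (_ : F y = set0)//; apply/seteqP; split=> // x.
  by rewrite /F theta_phi => -[].
have [n Hn] := uniform_finiteness SASR gdA dF finF.
(* The bound holds for all first coordinates in [A], hence by elementarity for the coordinate [b] in
   [M]. *)
have : sat SA (fall (fall (fneg (fstrip n theta)))) id.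
  by rewrite sat_all => y; rewrite sat_all => x; rewrite sat_neg sat_strip; exact: Hn.
rewrite satA sat_all => /(_ b); rewrite sat_all => H.
apply: (strip_finite SSR (n := n)) => x.
have := H x; rewrite sat_neg sat_strip.
rewrite (_ : (fun y => _) = D)//; apply/funext => y; rewrite theta_phi -Dphi.
rewrite (_ : (fun y => _) = D); last by apply/funext => z; rewrite Dphi.
by rewrite propeqE; split=> [[]|].
Qed.

Lemma good_setT (e : M) : e <' e +' e -> good [set e] -> good setT.
Proof.
move=> e0 ge.
(* The element [e] is adjoined outside the Zorn variable, so that the empty chain reduces to
   [ge]. *)
have [|A0 [gA0 A0max]] := @Zorn_bigcup _ (fun A => good (e |` A)).
  move=> F Fgood Ftot D /dfn_finite[B [Bfin BF]].
  have [Be|[X [FX BX]]] := finite_sub_chain Ftot Bfin BF.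
  - by move=> dD; apply: ge; exact: dfn_mono dD.
  - by move=> dD; apply: (Fgood _ FX); exact: dfn_mono dD.
have maxA b : good (b |` (e |` A0)) -> (e |` A0) b.
  move=> gb; apply: contrapT => nAb; apply: (A0max (b |` A0)).
    split=> [|H]; first exact: subsetUr.
    by apply: nAb; right; apply: H; left.
  by rewrite setUCA.
have clA x : dcl S (e |` A0) x -> (e |` A0) x.
  by move=> dx; apply: maxA => D /(dfn_dcl_add dx); exact: gA0.
move=> D dD; apply: (gA0); apply: dfn_mono dD => x _; apply: maxA.
by apply: (good_adjoin clA _ e0 gA0); left.
Qed.

End UniformFiniteness.

(** * Exchange *)

Section Closure.
Variables (R : realType) (L' : language) (E : structure L' R).
Let L := lang_sum ogroup_lang L'.
Let SR : structure L R := struct_sum (ogroup_struct R) E.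
Variables (M : Type) (S : structure L M).
Hypothesis SSR : theory_of S = theory_of SR.
Hypothesis gd : forall D : M -> Prop, dfn1 S setT D -> noint S D -> finite_set D.

Local Notation "x <' y" := (slt S x y) (at level 70).

Lemma dfn1_strip A (D : M -> Prop) n : dfn1 S A D -> dfn1 S A (strip S n D).
Proof.
have step D' : dfn1 S A D' -> dfn1 S A (fun x => D' x /\ exists y, D' y /\ y <' x).
  by move=> dD'; dfn_solve.
by move=> dD; elim: n => [//|n IH]; exact: (step (strip S n D)).
Qed.

(** [x] is the least element of [strip k D], where [k] is its rank in [D]. *)
Lemma finite_dcl A (D : M -> Prop) x :
  dfn1 S A D -> finite_set D -> D x -> dcl S A x.
Proof.
move=> dD /(finite_strip SSR)[n Hn] Dx.
have [k [kx nkx]] : exists k, strip S k D x /\ ~ strip S k.+1 D x.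
  apply: contrapT => H; apply: (Hn x); elim: {Hn} n => [//|n IH].
  by apply: contrapT => nx; apply: H; exists n.
have dk := dfn1_strip k dD.
have xmin y : strip S k D y -> ~ y <' x.
  by move=> ky yx; apply: nkx; split=> //; exists y.
apply: (@dfn_ext _ _ _ _ _ (fun v : unit -> M => strip S k D (v tt) /\
    forall y, strip S k D y -> ~ y <' v tt)); last by dfn_solve.
move=> v; split=> [[kv vmin]|->//].
have [vx|[//|xv]] := slt_total SSR (v tt) x; first by have := xmin _ kv vx.
by have := vmin _ kx xv.
Qed.

Lemma noint_dcl A (D : M -> Prop) x :
  dfn1 S A D -> noint S D -> D x -> dcl S A x.
Proof.
move=> dD niD; apply: finite_dcl => //; apply: gd => //.
exact: dfn_mono dD.
Qed.

(** [D] without its interior points is [A]-definable and has no interior, so its elements lie in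
    [dcl S A]. *)
Lemma itv_of_not_dcl A (D : M -> Prop) x : dfn1 S A D -> D x -> ~ dcl S A x ->
  exists p q, itv S p q x /\ forall y, itv S p q y -> D y.
Proof.
move=> dD Dx ndx; apply: contrapT => H; apply: ndx.
apply: (@noint_dcl _ (fun x => D x /\ ~ exists p q, itv S p q x /\ forall y, itv S p q y -> D y)) => //.
  by rewrite /itv; dfn_solve.
apply: not_hasint => -[a [b [ab Hab]]].
have [z zab] := slt_dense SSR ab; have [_] := Hab _ zab; apply.
by exists a, b; split=> // y /Hab[].
Qed.

Lemma hasint_of_not_dcl A (D : M -> Prop) x : dfn1 S A D -> D x -> ~ dcl S A x ->
  hasint S D.
Proof.
move=> dD Dx /(itv_of_not_dcl dD Dx) [p [q [xpq H]]].
by exists p, q; split=> //; exact: (itv_nonempty SSR xpq).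
Qed.

(** If [b] were not in the closure, [Q a] would have interior, and so would [Q x] for all [x] in an
    interval around [a]. By [fubini] one [y] would then be related to a whole interval of [x]. *)
Lemma dcl_exchange A a b : dcl S (b |` A) a -> ~ dcl S A a -> dcl S (a |` A) b.
Proof.
move=> dab nda; have [Y dY HY] := dfn_addE dab.
(* The graph of a partial function from [y] to [x], with value [a] at [b]. *)
pose Q x y := Y (oapp (fun _ : unit => x) y) /\
  forall x', Y (oapp (fun _ : unit => x') y) -> x' = x.
have HYb x : Y (oapp (fun _ : unit => x) b) = (x = a) by rewrite -HY.
have dQ : dfn2 S A Q.
  have dYv V (i j : V) : dfn S A (fun v => Y (oapp (fun _ : unit => v i) (v j))).
    apply: (@dfn_ext _ _ _ _ _ (fun v => Y (fun o => v (if o is Some _ then i else j)))).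
      by move=> v; rewrite (_ : (fun o => _) = oapp (fun=> v i) (v j))//; apply/funext => -[].
    exact: dfn_sub dY.
  rewrite /dfn2 /Q; apply: dfn_and; first exact: dYv.
  by apply: dfn_all; apply: dfn_imp; [exact: dYv|apply: dfn_eq; exact: dft_var].
have Qab : Q a b by split; [rewrite HYb|move=> x'; rewrite HYb].
apply: contrapT => ndb.
have hQa : hasint S (Q a).
  apply: (@hasint_of_not_dcl (a |` A) _ b) => //.
  have dQ' : dfn2 S (a |` A) Q by apply: dfn_mono dQ => x; right.
  by apply: (dfn2_term dQ'); [apply: dft_par; left|exact: dft_var].
have [p [q [apq Hpq]]] : exists p q, itv S p q a /\ forall x, itv S p q x -> hasint S (Q x).
  by apply: (@itv_of_not_dcl A) => //; rewrite /hasint /itv; dfn_solve.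
have dQT : dfn2 S setT Q by exact: dfn_mono dQ.
have [y [c [d [cd Hcd]]]] := fubini SSR gd dQT (itv_nonempty SSR apq) Hpq.
have [x [cx xd]] := slt_dense SSR cd; have [z [cz zx]] := slt_dense SSR cx.
have [_ Hx] := Hcd x (conj cx xd).
have [Qz _] := Hcd z (conj cz (slt_trans SSR zx xd)).
by apply: (slt_irr SSR (x := x)); rewrite -{1}(Hx _ Qz).
Qed.

End Closure.

(** * Lovely pairs *)

Lemma finite_conj L V (I : Type) (B : set I) (f : I -> formula L V) :
  finite_set B -> exists psi : formula L V,
    forall M (S : structure L M) v, sat S psi v <-> forall i, B i -> sat S (f i) v.
Proof.
move=> Bf; elim/finite_set_rect_prop : Bf => [|i {}B _ [psi Hpsi]].
  by exists (fimp (fbot _ _) (fbot _ _)) => M S v /=; split.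
exists (fand (f i) psi) => M S v; rewrite sat_and Hpsi.
by split=> [[fi fB] j [->|/fB]|H]//; split=> [|j Bj]; apply: H; [left|right].
Qed.

Definition case_env (M V W : Type) (v : V -> M) (z : W -> M) (i : V + W) : M :=
  match i with inl i => v i | inr j => z j end.

Lemma exists_block L V m (phi : formula L (V + fin m)) : exists chi : formula L V,
  forall M (S : structure L M) v,
    sat S chi v <-> exists z : fin m -> M, sat S phi (case_env v z).
Proof.
elim: m V phi => [|m IH] V phi.
  exists (frename (fun i : V + void => match i with inl i => i | inr j => of_void V j end) phi).
  move=> M S v; rewrite sat_rename.
  have vE z : v \o (fun i : V + void => match i with inl i => i | inr j => of_void V j end) =
      case_env v z by apply/funext => -[].
  split=> [|[z]]; last by rewrite (vE z).
  by rewrite (vE (of_void M)); exists (of_void M).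
pose h (i : V + option (fin m)) : option V + fin m :=
  match i with inl i => inl (Some i) | inr None => inl None | inr (Some j) => inr j end.
have [chi Hchi] := IH (option V) (frename h phi).
exists (fex chi) => M S v; rewrite sat_ex.
have hE x z : case_env (oapp v x) z \o h = case_env v (oapp z x).
  by apply/funext => -[i|[j|]].
split=> [[x /Hchi[z]]|[z]].
  by rewrite sat_rename hE; exists (oapp z x).
move=> Hz; exists (z None); apply/Hchi; exists (fun j => z (Some j)).
rewrite sat_rename hE (_ : oapp _ _ = z)//.
by apply/funext => -[].
Qed.

Section Pairs.
Variable L : language.

Fixpoint tlift (V : Type) (t : term L V) : term (pair_lang L) V :=
  match t with
  | tvar x => tvar (pair_lang L) x
  | tapp f ts => @tapp (pair_lang L) V (inl f) (fun i => tlift (ts i))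
  end.

Fixpoint flift (V : Type) (phi : formula L V) : formula (pair_lang L) V :=
  match phi with
  | fbot => fbot (pair_lang L) _
  | feq s t => feq (tlift s) (tlift t)
  | Defs.frel r ts => @Defs.frel (pair_lang L) _ (inl r) (fun i => tlift (ts i))
  | fimp phi psi => fimp (flift phi) (flift psi)
  | fall phi => fall (flift phi)
  end.

Definition fmem V (i : V) : formula (pair_lang L) V :=
  @Defs.frel (pair_lang L) V (inr tt) (fun=> tvar (pair_lang L) i).

Section Semantics.
Variables (M : Type) (S : structure L M) (P : set M).

Lemma eval_lift V (t : term L V) v : eval (expand_pred S P) v (tlift t) = eval S v t.
Proof. by elim: t => //= f ts IH; congr finterp; apply/funext => i. Qed.

Lemma sat_lift V (phi : formula L V) v :
  sat (expand_pred S P) (flift phi) v = sat S phi v.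
Proof.
elim: phi v => //= [{}V s t|{}V r ts|{}V phi IH1 psi IH2|{}V phi IH] v.
- by rewrite !eval_lift.
- by congr rinterp; apply/funext => i; rewrite eval_lift.
- by rewrite IH1 IH2.
- by apply: eq_forall => x.
Qed.

Lemma dfn_lift A V (X : (V -> M) -> Prop) : dfn S A X -> dfn (expand_pred S P) A X.
Proof. by move=> [phi H]; exists (flift phi) => v; rewrite sat_lift. Qed.

Lemma dfn_mem A : dfn1 (expand_pred S P) A P.
Proof. by exists (fmem (inl tt)). Qed.

End Semantics.

Variable T : set (sentence L).

(** The type comes from an ultrafilter containing every set that covers [D] up to finitely many
    points; in particular it contains all cofinite sets, so its members are infinite. *)
Lemma nonalgebraic_type_ex N (S : structure L N) (A : set N) (D : set N) :
  dfn1 S A D -> infinite_set D -> exists q : set (formula1 L A),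
    [/\ complete_type S q, nonalgebraic_type S q &
        forall x, realizes S q x -> D x].
Proof.
move=> dD infD; have [|U [UU FU]] := @fip_ultra _ [set X | finite_set (D `\` X)].
  move=> F Ff FD; apply: contrapT => H; apply: infD.
  apply: (@sub_finite_set _ _ (\bigcup_(X in F) (D `\` X))); last exact: bigcup_finite.
  move=> x Dx; apply: contrapT => Hx; apply: H; exists x => X FX.
  by apply: contrapT => nXx; apply: Hx; exists X.
have [phi Dphi] : definable_over S A D by exact/definable_overE.
exists [set phi | U (solutions S phi)]; split.
- split=> [q0 q0q q0f|psi]; last first.
    by have [|] := in_ultra_setVsetC (solutions S psi) UU; [left|right].
  have : U (\bigcap_(phi in q0) solutions S phi) by exact: filter_bigcap_finite.
  by move=> /filter_ex [x Hx]; exists x.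
- move=> psi Upsi fin.
  have Uc : U (~` solutions S psi).
    by apply: FU; apply: sub_finite_set fin => x [_ /= /contrapT].
  by have /filter_ex[x []] : U (solutions S psi `&` ~` solutions S psi) by exact: filterI.
- move=> x Hx; rewrite Dphi; apply: Hx => /=; rewrite -Dphi; apply: FU.
  by rewrite /= setDv.
Qed.

(** [lovely_theory] is the common theory of the lovely pairs, so an axiom is verified in these, for
    finitely many parameters at a time. *)
Lemma lovely_transfer M (S : structure L M) (P : set M) V
    (theta : formula (pair_lang L) V) :
  models (expand_pred S P) (lovely_theory T) ->
  (forall N (S' : structure L N) Q, lovely_pair T S' Q ->
    forall w : V -> N, finite_set (range w) -> sat (expand_pred S' Q) theta w) ->
  forall w, sat (expand_pred S P) theta w.
Proof.
move=> mod H; have [sigma [s1 s2]] := universal_closure theta.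
by apply: s2; apply: mod => N S' Q lov; apply: s1; exact: H.
Qed.

Lemma lovely_dcl M (S : structure L M) (P : set M) :
  models (expand_pred S P) (lovely_theory T) -> forall x, dcl S P x -> P x.
Proof.
move=> mod x /dfn_finite[B [Bf BP [phi Hphi]]].
pose phi' : formula L (option B) :=
  frename (fun i => match i with inl _ => None | inr b => Some b end) phi.
have [psi Hpsi] : exists psi : formula (pair_lang L) B,
    forall M (S : structure (pair_lang L) M) v,
      sat S psi v <-> forall i : B, [set: B] i -> sat S (fmem i) v.
  apply: finite_conj; rewrite -(_ : (fun b : B => \val b) @^-1` B = setT).
    by apply: finite_preimage Bf => ? ? _ _; exact: val_inj.
  by apply/seteqP; split=> // b _; exact: (set_mem (valP b)).
pose uniq_phi : formula L (option B) :=
  fall (fimp (frename (omap Some) phi') (feq (tvar L None) (tvar L (Some None)))).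
have uniqE N (S' : structure L N) w y : sat S' uniq_phi (oapp w y) =
    forall z, sat S' phi' (oapp w z) -> z = y.
  rewrite /uniq_phi sat_all; apply: eq_forall => z; rewrite sat_imp sat_rename.
  by rewrite (_ : _ \o _ = oapp w z)//; apply/funext => -[].
(* Says that a point defined by [phi'] from parameters in the predicate is in the predicate. In a
   lovely pair this holds because the elementary substructure contains a solution of [phi']. *)
pose theta := fimp psi (fall (fimp (flift (fand phi' uniq_phi)) (fmem None))).
have thetaE N (S' : structure L N) Q w : sat (expand_pred S' Q) theta w <->
    ((forall b : B, Q (w b)) -> forall y, sat S' phi' (oapp w y) ->
     (forall z, sat S' phi' (oapp w z) -> z = y) -> Q y).
  rewrite /theta sat_imp Hpsi sat_all; split=> H.
    move=> Qw y phiy uy; have := H (fun b _ => Qw b) y.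
    by rewrite sat_imp sat_lift sat_and uniqE; exact.
  move=> Qw y; rewrite sat_imp sat_lift sat_and uniqE => -[phiy uy].
  by apply: (H _ y) => // b; exact: Qw.
have xE y : sat S phi' (oapp (fun b : B => \val b) y) = (y = x).
  rewrite sat_rename (Hphi (fun=> y)); congr sat.
  by apply/funext => -[].
suff /thetaE/(_ _ x) : sat (expand_pred S P) theta (fun b : B => \val b).
  by apply=> [b||z]; rewrite ?xE//; apply: BP; exact: (set_mem (valP b)).
apply: lovely_transfer mod _ _ => N S' Q lov w _; apply/thetaE => Qw y phiy uy.
have [S'' emb] := lovely_elementary lov.
pose w' b : Q := SigSub (mem_set (Qw b)).
have [z Hz] : exists z, sat S'' phi' (oapp w' z).
  rewrite -sat_ex; apply/(emb _ (fex phi') w'); rewrite sat_ex.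
  by exists y.
have /(emb _ phi') := Hz.
rewrite (_ : _ \o _ = oapp w (\val z)) => [/uy <-|]; last by apply/funext => -[].
exact: (set_mem (valP z)).
Qed.

(** Membership in the closure of the parameters and the predicate is an infinite disjunction over
    [psi]; each disjunct is one formula of the pair. *)
Lemma graph_formula (A : Type) m (psi : formula L (option (A + fin m))) :
  exists chi : formula (pair_lang L) (option A),
  forall N (S' : structure L N) Q w x, sat (expand_pred S' Q) chi (oapp w x) <->
    exists z : fin m -> N, (forall j, Q (z j)) /\
      forall y, sat S' psi (oapp (case_env w z) y) <-> y = x.
Proof.
have [inP HinP] := finite_conj (fun j => @fmem (option A + fin m) (inr j)) (finite_fin m).
pose r (o : option (A + fin m)) : option (option A + fin m) :=
  match o with
  | None => None | Some (inl a) => Some (inl (Some a)) | Some (inr j) => Some (inr j)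
  end.
pose e : formula L (option (option A + fin m)) :=
  feq (tvar L None) (tvar L (Some (inl None))).
pose body := fand inP (flift (fall (fand (fimp (frename r psi) e) (fimp e (frename r psi))))).
have [chi Hchi] := exists_block body.
exists chi => N S' Q w x; rewrite Hchi.
have rE z y : oapp (case_env (oapp w x) z) y \o r = oapp (case_env w z) y.
  by apply/funext => -[[]|].
have bodyE z : sat (expand_pred S' Q) body (case_env (oapp w x) z) <->
    ((forall j, Q (z j)) /\ forall y, sat S' psi (oapp (case_env w z) y) <-> y = x).
  rewrite /body sat_and HinP sat_lift sat_all.
  split=> -[Qz H]; split; [by move=> j; exact: (Qz j)| |by move=> j _; exact: (Qz j)|] => y.
    by have := H y; rewrite sat_and !sat_imp sat_eq sat_rename rE.
  by rewrite sat_and !sat_imp sat_eq sat_rename rE; have [] := H y.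
by split=> -[z Hz]; exists z; apply/bodyE.
Qed.

Lemma dcl_param_graph N (S : structure L N) (A P : set N) p0 x : P p0 ->
  dcl S (A `|` P) x -> exists m (psi : formula L (option (A + fin m))) (z : fin m -> N),
    (forall j, P (z j)) /\
    forall y, sat S psi (oapp (case_env (fun a : A => \val a) z) y) <-> y = x.
Proof.
move=> Pp0 [phi Hphi]; have [n [h [g gh]]] := formula_factor phi.
pose r (k : fin n) : option (A + fin n) := match g k with
  | inl _ => None
  | inr a => match pselect (A (\val a)) with
             | left Aa => Some (inl (SigSub (mem_set Aa))) | right _ => Some (inr k) end
  end.
(* [p0] fills the coordinates that do not name an element of [P]. *)
pose z (k : fin n) : N := match g k with
  | inl _ => p0 | inr a => if pselect (P (\val a)) then \val a else p0 end.
exists n, (frename r (frename h phi)), z; split.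
  by move=> k; rewrite /z; case: (g k) => // a; case: pselect.
move=> y; have -> : (y = x) = sat S phi (param_env (fun=> y)) by exact: (Hphi (fun=> y)).
rewrite -(gh _ _ (param_env _)) !sat_rename.
suff -> : oapp (case_env (fun a : A => \val a) z) y \o r =
    param_env (A := A `|` P) (fun _ : unit => y) \o g by [].
apply/funext => k; rewrite /r /z /=; case E : (g k) => [//|a] /=.
case: pselect => //= nAa; rewrite E; case: pselect => //= nPa.
by have := set_mem (valP a) => -[].
Qed.

Lemma lovely_not_acl N (S : structure L N) Q (A : set N) :
  lovely_pair T S Q -> infinite_set [set: N] -> finite_set A ->
  exists x, ~ acl S (A `|` Q) x.
Proof.
move=> lov infN Af.
have dT : dfn1 S A setT by exact: dfn_const.
have [q [cq naq _]] := nonalgebraic_type_ex dT infN.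
by have [x [nx _]] := lovely_extension lov Af cq naq; exists x.
Qed.

(** Saturation realizes the type of a point outside the closure: a finite part of it involves
    finitely many parameters, over which the extension property of lovely pairs gives a
    realization. *)
Lemma not_dcl_small M (S : structure L M) (P A : set M) p0 :
  models (expand_pred S P) (lovely_theory T) -> saturated (expand_pred S P) ->
  (forall N (S' : structure L N) Q, lovely_pair T S' Q -> infinite_set [set: N]) ->
  P p0 -> card_lt A [set: M] -> exists x, ~ dcl S (A `|` P) x.
Proof.
move=> mod satS inf_lovely Pp0 Asmall.
pose graph (chi : formula (pair_lang L) (option A)) :=
  exists m (psi : formula L (option (A + fin m))),
  forall N (S' : structure L N) Q w x, sat (expand_pred S' Q) chi (oapp w x) <->
    exists z : fin m -> N, (forall j, Q (z j)) /\
      forall y, sat S' psi (oapp (case_env w z) y) <-> y = x.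
pose B := [set D : set M | exists chi, graph chi /\
  D = (fun x => ~ sat (expand_pred S P) chi (oapp (fun a : A => \val a) x))].
have [| |x Hx] := saturated_fip (B := B) satS Asmall.
- move=> _ [chi [_ ->]]; apply/definable_overE; exists (fneg chi); reflexivity.
- move=> F Ff FB.
  have /choice[c Hc] : forall D, exists chi, F D -> graph chi /\
      D = (fun x => ~ sat (expand_pred S P) chi (oapp (fun a : A => \val a) x)).
    move=> D; have [/FB[chi Hchi]|nFD] := pselect (F D); first by exists chi.
    by exists (fbot _ _).
  have [theta Htheta] := finite_conj (fun D => fneg (c D)) Ff.
  have : sat (expand_pred S P) (fex theta) (fun a : A => \val a).
    apply: lovely_transfer mod _ _ => N S' Q lov w wf; rewrite sat_ex.
    have [x nx] := lovely_not_acl lov (inf_lovely _ _ _ lov) wf.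
    exists x; apply/Htheta => D FD; rewrite sat_neg.
    have [[m [psi ->]] _] := Hc _ FD.
    move=> [z [Qz Hz]]; apply/nx/dcl_acl.
    have Hp i : (range w `|` Q) (case_env w z i).
      by case: i => [a|j] /=; [left; exists a|right].
    apply: dfn_ext (dfn1_params S' psi Hp) => v; exact: Hz.
  rewrite sat_ex => -[x /Htheta Hx]; exists x => D FD.
  by have [_ ->] := Hc _ FD; rewrite -sat_neg; exact: Hx.
exists x => /(dcl_param_graph Pp0)[m [psi [z [Pz Hz]]]].
have [chi Hchi] := graph_formula psi.
apply: (Hx (fun x => ~ sat (expand_pred S P) chi (oapp (fun a : A => \val a) x))).
  by exists chi; split=> //; exists m, psi.
by apply/Hchi; exists z.
Qed.

End Pairs.

(** * The monster model of the theory of lovely pairs *)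

Lemma models_complete L M N (S : structure L M) (S' : structure L N) :
  models S (theory_of S') -> theory_of S = theory_of S'.
Proof.
move=> mod; apply/seteqP; split=> // phi Sphi.
apply: contrapT => nphi.
by have := mod (fneg phi); apply.
Qed.

Lemma countable_small (Lam M : Type) (A : set M) :
  strongly_inaccessible Lam -> [set: M] #= [set: Lam] -> countable A ->
  card_lt A [set: M].
Proof.
move=> inacc ML cA; apply/negP => MA; move/negP: (inacc_uncountable inacc); apply.
have [_ LM] := (iffLR (card_eqPle _ _)) ML.
exact: card_le_trans LM (card_le_trans MA cA).
Qed.

Section Monster.
Variables (R : realType) (L' : language) (E : structure L' R).
Let L := lang_sum ogroup_lang L'.
Let SR : structure L R := struct_sum (ogroup_struct R) E.
Hypothesis omin : o_minimal SR.
Variables (M : Type) (S : structure L M) (P : set M).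
Hypothesis mod : models (expand_pred S P) (lovely_theory (theory_of SR)).
Hypothesis satS : saturated (expand_pred S P).
Hypothesis small : forall A : set M, countable A -> card_lt A [set: M].

Local Notation "x <' y" := (slt S x y) (at level 70).

Lemma monster_theory : theory_of S = theory_of SR.
Proof.
apply: models_complete => phi Rphi; rewrite /theory_of /= -(sat_lift S P).
apply: lovely_transfer mod _ _ => N S' Q lov w _; rewrite sat_lift.
have := lovely_models lov Rphi.
by rewrite /theory_of/= (_ : of_void N = w)//; apply/funext => -[].
Qed.

Let SSR := monster_theory.

Lemma lovely_infinite N (S' : structure L N) Q :
  lovely_pair (theory_of SR) S' Q -> infinite_set [set: N].
Proof.
move=> lov; have NSR := models_complete (lovely_models lov).
have [e _] := ex_pos NSR; have [b eb] := ex_gt NSR e.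
by move=> /(sub_finite_set (@subsetT _ (itv S' e b))); exact: (itv_infinite NSR eb).
Qed.

Lemma monster_dense x y : x <' y -> exists p, P p /\ itv S x y p.
Proof.
pose theta : formula (pair_lang L) bool :=
  fimp (flift (flt (tvar L true) (tvar L false)))
    (fex (fand (fmem L None) (flift (fand (flt (tvar L (Some true)) (tvar L None))
                                        (flt (tvar L None) (tvar L (Some false))))))).
have thetaE N (S' : structure L N) Q w : sat (expand_pred S' Q) theta w =
    (slt S' (w true) (w false) -> exists p, Q p /\ itv S' (w true) (w false) p).
  rewrite /theta sat_imp sat_lift sat_lt sat_ex; congr (_ -> _).
  by apply: eq_exists => p; rewrite sat_and sat_lift sat_and !sat_lt.
suff : sat (expand_pred S P) theta (fun b => if b then x else y) by rewrite thetaE.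
apply: lovely_transfer mod _ _ => N S' Q lov w wf; rewrite thetaE => ww.
have NSR := models_complete (lovely_models lov).
have dD : dfn1 S' (range w) (itv S' (w true) (w false)).
  rewrite /dfn1 /itv; apply: dfn_and; apply: dfn_lt; try exact: dft_var.
    by apply: dft_par; exists true.
  by apply: dft_par; exists false.
have [q [cq naq Hq]] := nonalgebraic_type_ex dD (itv_infinite NSR ww).
by have [p [Qp /Hq pw]] := lovely_coheir lov wf cq naq; exists p.
Qed.

Lemma monster_dcl x : dcl S P x -> P x.
Proof. exact: lovely_dcl mod x. Qed.

Lemma monster_not_dcl A : countable A -> exists x, ~ dcl S (A `|` P) x.
Proof.
move=> cA; have [e _] := ex_pos SSR; have [b eb] := ex_gt SSR e.
have [p [Pp _]] := monster_dense eb.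
apply: (not_dcl_small mod satS lovely_infinite Pp); exact: small.
Qed.

(** Saturation of the pair is applied to the traces on [P] of the sets in [B]; finitely many are met
    by density of [P]. Having [setT] in [B] puts the realization in [P]. *)
Lemma monster_realize A (B : set (set M)) : finite_set A -> B setT ->
  (forall D, B D -> dfn1 S A D) ->
  (forall F, finite_set F -> F `<=` B -> hasint S (fun x => forall D, F D -> D x)) ->
  exists p, P p /\ forall D, B D -> D p.
Proof.
move=> Af BT dB HB.
have [|_ [D [BD ->]]|F Ff FB|p Hp] := @saturated_fip _ _ _ A [set X | exists D, B D /\ X = P `&` D] satS.
- exact/small/finite_set_countable.
- by apply: dfn_and; [exact: dfn_mem|apply: dfn_lift; exact: dB].
- have /choice[g Hg] : forall X, exists D, F X -> B D /\ X = P `&` D.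
    move=> X; have [/FB[D HD]|nFX] := pselect (F X); first by exists D.
    by exists setT.
  have [||a [b [ab Hab]]] := HB (g @` F).
  + exact: finite_image.
  + by move=> _ [X FX <-]; have [] := Hg _ FX.
  have [p [Pp pab]] := monster_dense ab; exists p => X FX.
  by have [_ XE] := Hg _ FX; rewrite XE; split=> //; apply: Hab => //; exists X.
- have [|Pp _] := Hp (P `&` setT); first by exists setT.
  exists p; split=> // D BD.
  by have [|_ //] := Hp (P `&` D); exists D.
Qed.

Lemma saturated_reduct A (B : set (set M)) : finite_set A ->
  (forall D, B D -> dfn1 S A D) ->
  (forall F, finite_set F -> F `<=` B -> exists x, forall D, F D -> D x) ->
  exists x, forall D, B D -> D x.
Proof.
move=> Af dB HB; apply: (saturated_fip (S := expand_pred S P) (A := A)) => //.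
  exact/small/finite_set_countable.
by move=> D BD; apply/dfn_lift/dB.
Qed.

Lemma monster_finite : forall D : M -> Prop, dfn1 S setT D -> noint S D -> finite_set D.
Proof.
(* [e] realizes the type of the real number 1, as [good_type] asks. *)
have [||e He] := @saturated_reduct set0 [set D | exists phi : formula L unit,
    sat SR phi (fun=> 1%R) /\ D = (fun x => sat S phi (fun=> x))] (finite_set0 _).
- move=> _ [phi [_ ->]]; exists (frename inl phi) => v.
  by rewrite sat_rename; congr sat; apply/funext => -[].
- move=> F Ff FB.
  have /choice[g Hg] : forall D, exists phi : formula L unit, F D ->
      sat SR phi (fun=> 1%R) /\ D = (fun x => sat S phi (fun=> x)).
    move=> D; have [/FB[phi Hphi]|nFD] := pselect (F D); first by exists phi.
    by exists (fbot _ _).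
  have [psi Hpsi] := finite_conj g Ff.
  have Rpsi : sat SR psi (fun=> 1%R) by apply/Hpsi => D /Hg[].
  have : sat S (fex (frename (fun=> None) psi)) (of_void M).
    apply: (transfer SSR (phi := fex (frename (fun=> None) psi))) => v.
    by rewrite sat_ex; exists 1%R; rewrite sat_rename.
  rewrite sat_ex => -[x]; rewrite sat_rename => /Hpsi Hx.
  by exists x => D FD; have [_ ->] := Hg _ FD; exact: Hx.
have tp_e (phi : formula L unit) : sat SR phi (fun=> 1%R) -> sat S phi (fun=> e).
  by move=> Rphi; apply: (He (fun x => sat S phi (fun=> x))); exists phi.
apply: (good_setT omin SSR (e := e)); last exact: (good_type omin SSR).
have := tp_e (flt (tvar L tt) (tadd (tvar L tt) (tvar L tt))).
by rewrite !satE; apply; rewrite slt_real sadd_real /=; lra.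
Qed.

End Monster.

(** * Back and forth *)

Section BackAndForth.
Variables (R : realType) (L' : language) (E : structure L' R).
Let L := lang_sum ogroup_lang L'.
Let SR : structure L R := struct_sum (ogroup_struct R) E.
Variables (M : Type) (S : structure L M).
Hypothesis SSR : theory_of S = theory_of SR.
Hypothesis gd : forall D : M -> Prop, dfn1 S setT D -> noint S D -> finite_set D.
Hypothesis satS : forall A (B : set (set M)), finite_set A ->
  (forall D, B D -> dfn1 S A D) ->
  (forall F, finite_set F -> F `<=` B -> exists x, forall D, F D -> D x) ->
  exists x, forall D, B D -> D x.

Local Notation "x <' y" := (slt S x y) (at level 70).
Local Notation "x +' y" := (sadd S x y) (at level 50, left associativity).

Ltac og l := og_with SSR l.

Record rich (D : set M) : Prop := Rich {
  rich_dcl : forall x, dcl S D x -> D x;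
  rich_dense : forall x y, x <' y -> exists p, D p /\ itv S x y p;
  rich_realize : forall A (B : set (set M)), finite_set A -> B setT ->
    (forall X, B X -> dfn1 S A X) ->
    (forall F, finite_set F -> F `<=` B -> hasint S (fun x => forall X, F X -> X x)) ->
    exists p, D p /\ forall X, B X -> X p;
  rich_not_dcl : forall A, finite_set A -> exists x, ~ dcl S (A `|` D) x
}.

(* Independence of [A] from [D] over [A `&` D]; quantifying over [B] makes it stable under
   adding elements of [D]. *)
Definition free (D A : set M) := forall B, B `<=` D -> forall y, D y ->
  dcl S (A `|` B) y -> dcl S ((A `&` D) `|` B) y.

(** A relation rather than a function, so that [back] is [forth] for the swapped relation; equality
    formulas make it functional and injective. *)
Definition elementary_map (rho : set (M * M)) :=
  forall V (phi : formula L V) v v', (forall i, rho (v i, v' i)) ->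
    sat S phi v -> sat S phi v'.

Definition dom (rho : set (M * M)) : set M := fst @` rho.
Definition cod (rho : set (M * M)) : set M := snd @` rho.

Record partial_iso (D1 D2 : set M) (rho : set (M * M)) : Prop := PartialIso {
  pi_finite : finite_set rho;
  pi_elementary : elementary_map rho;
  pi_mem : forall x x', rho (x, x') -> (D1 x <-> D2 x');
  pi_free_dom : free D1 (dom rho);
  pi_free_cod : free D2 (cod rho)
}.

Lemma free0 D : free D set0.
Proof. by move=> B _ y _; rewrite set0U set0I set0U. Qed.

Lemma free_add_mem D A x : free D A -> D x -> free D (x |` A).
Proof.
move=> fA Dx B BD y Dy dy.
have xBD : x |` B `<=` D by move=> z [->|/BD].
have : dcl S ((A `&` D) `|` (x |` B)) y.
  by apply: fA => //; apply: dcl_mono dy => z [[->|Az]|Bz]; [right; left|left|right; right].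
apply: dcl_mono => z [[Az Dz]|[->|Bz]]; [left|left|by right].
  by split=> //; right.
by split=> //; left.
Qed.

(** If an element of [D] depended on [x] over [A] and [B], exchange would make [x] depend on [A] and
    [D]. *)
Lemma free_add_indep D A x : free D A -> ~ dcl S (A `|` D) x -> free D (x |` A).
Proof.
move=> fA nx B BD y Dy; rewrite -setUA => dy.
have [dy'|ndy] := pselect (dcl S (A `|` B) y).
  apply: dcl_mono (fA B BD y Dy dy') => z [[Az Dz]|Bz]; [left|by right].
  by split=> //; right.
exfalso; apply: nx; apply: dcl_mono (dcl_exchange SSR gd dy ndy) => z [->|[Az|/BD]].
- by right.
- by left.
- by right.
Qed.

Lemma free_add_dcl D A x : free D A -> dcl S A x -> free D (x |` A).
Proof.
move=> fA dx B BD y Dy dy.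
have : dcl S (A `|` B) y.
  apply: dcl_trans dy => z [[->|Az]|Bz].
  - by apply: dcl_mono dx => w; left.
  - by apply: dcl_par; left.
  - by apply: dcl_par; right.
move=> /(fA B BD y Dy); apply: dcl_mono => z [[Az Dz]|Bz]; [left|by right].
by split=> //; right.
Qed.

Section TypeTransport.
Variables (I : Type) (a a' : I -> M).

Definition same_type (x x' : M) := forall phi : formula L (option I),
  sat S phi (oapp a x) -> sat S phi (oapp a' x').

Lemma same_typeE x x' : same_type x x' ->
  forall phi : formula L (option I), sat S phi (oapp a x) = sat S phi (oapp a' x').
Proof.
move=> xx' phi; rewrite propeqE; split; first exact: xx'.
by apply: contraPP => H; exact: (xx' (fneg phi)).
Qed.

Lemma dcl_image_formula (K : set I) x : dcl S (a @` K) x ->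
  exists phi : formula L (option K),
    forall y, sat S phi (oapp (fun k : K => a (\val k)) y) <-> y = x.
Proof.
move=> [phi Hphi].
have /choice[g Hg] (b : a @` K) : exists k : K, a (\val k) = \val b.
  by have [i Ki ai] := set_mem (valP b); exists (SigSub (mem_set Ki)).
exists (frename (fun z => match z with inl _ => None | inr b => Some (g b) end) phi) => y.
have -> : (y = x) = sat S phi (param_env (fun=> y)) by exact: (Hphi (fun=> y)).
rewrite sat_rename (_ : _ \o _ = param_env (fun=> y))//.
by apply/funext => -[//|b] /=; rewrite Hg.
Qed.

(** Being the only solution of a given formula is again a formula, hence part of the type. *)
Lemma dcl_same_type (K : set I) x x' :
  same_type x x' -> dcl S (a @` K) x -> dcl S (a' @` K) x'.
Proof.
move=> xx' /dcl_image_formula[phi Hphi].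
pose r (o : option K) : option I := omap (fun k : K => \val k) o.
pose chi : formula L (option I) := fall (fand
  (fimp (frename (omap (Some \o (fun k : K => \val k))) phi)
        (feq (tvar L None) (tvar L (Some None))))
  (fimp (feq (tvar L None) (tvar L (Some None)))
        (frename (omap (Some \o (fun k : K => \val k))) phi))).
have chiE (b : I -> M) z : sat S chi (oapp b z) <->
    forall y, sat S phi (oapp (fun k : K => b (\val k)) y) <-> y = z.
  have bE y : oapp (oapp b z) y \o omap (Some \o (fun k : K => \val k)) =
      oapp (fun k : K => b (\val k)) y by apply/funext => -[].
  by rewrite sat_all; split=> H y; have := H y; rewrite sat_and !sat_imp sat_rename bE.
have /xx' /chiE H : sat S chi (oapp a x) by exact/chiE.
have a'K (k : K) : (a' @` K) (a' (\val k)).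
  by exists (\val k) => //; exact: (set_mem (valP k)).
apply: dfn_ext (dfn1_params S phi a'K) => v; exact: H.
Qed.

End TypeTransport.

Section Forth.
Variables (D1 D2 : set M) (rho : set (M * M)).
Hypothesis rho_iso : partial_iso D1 D2 rho.

Let a (i : rho) : M := (\val i).1.
Let a' (i : rho) : M := (\val i).2.

Lemma rho_val (i : rho) : rho (a i, a' i).
Proof. by have := set_mem (valP i); rewrite /a /a'; case: (\val i). Qed.

Lemma dom_image : dom rho = a @` setT.
Proof.
apply/seteqP; split=> [_ [p rp <-]|_ [i _ <-]].
  by exists (SigSub (mem_set rp)).
by exists (a i, a' i) => //; exact: rho_val.
Qed.

Lemma cod_image : cod rho = a' @` setT.
Proof.
apply/seteqP; split=> [_ [p rp <-]|_ [i _ <-]].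
  by exists (SigSub (mem_set rp)).
by exists (a i, a' i) => //; exact: rho_val.
Qed.

Lemma finite_cod : finite_set (cod rho).
Proof. exact/finite_image/(pi_finite rho_iso). Qed.

Lemma elementary_map_add x x' : same_type a a' x x' ->
  elementary_map ((x, x') |` rho).
Proof.
move=> xx' V phi v v' vv'.
have /choice[h Hh] i : exists o : option rho, oapp a x o = v i /\ oapp a' x' o = v' i.
  have [[<- <-]|ri] := vv' i; first by exists None.
  by exists (Some (SigSub (mem_set ri))).
have -> : v = oapp a x \o h by apply/funext => i; have [] := Hh i.
have -> : v' = oapp a' x' \o h by apply/funext => i; have [] := Hh i.
by rewrite -!sat_rename; exact: xx'.
Qed.

(** The type of [x] over [dom rho], with its parameters moved to [cod rho]. *)
Definition transported (x : M) : set (set M) :=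
  [set X | exists phi : formula L (option rho),
     sat S phi (oapp a x) /\ X = (fun y => sat S phi (oapp a' y))].

Lemma transported_dfn x X : transported x X -> dfn1 S (cod rho) X.
Proof.
move=> [phi [_ ->]]; apply: dfn1_params => i.
by rewrite cod_image; exists i.
Qed.

Lemma transported_conj x F : finite_set F -> F `<=` transported x ->
  exists phi : formula L (option rho), sat S phi (oapp a x) /\
    forall y, sat S phi (oapp a' y) -> forall X, F X -> X y.
Proof.
move=> Ff FB.
have /choice[g Hg] : forall X, exists phi : formula L (option rho), F X ->
    sat S phi (oapp a x) /\ X = (fun y => sat S phi (oapp a' y)).
  move=> X; have [/FB[phi Hphi]|nFX] := pselect (F X); first by exists phi.
  by exists (fbot _ _).
have [psi Hpsi] := finite_conj g Ff; exists psi.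
split=> [|y /Hpsi Hy X FX]; first by apply/Hpsi => X /Hg[].
by have [_ ->] := Hg _ FX; exact: Hy.
Qed.

Lemma transported_ex x (phi : formula L (option rho)) :
  sat S phi (oapp a x) -> exists y, sat S phi (oapp a' y).
Proof.
move=> Hphi; rewrite -sat_ex; apply: (pi_elementary rho_iso) rho_val _.
by rewrite sat_ex; exists x.
Qed.

Lemma same_type_ex x : exists x', same_type a a' x x'.
Proof.
have [|F Ff FB|x' Hx'] := satS (B := transported x) finite_cod.
- exact: transported_dfn.
- have [phi [Hphi H]] := transported_conj Ff FB.
  by have [y /H Hy] := transported_ex Hphi; exists y.
- by exists x' => phi Hphi; apply: (Hx' (fun y => sat S phi (oapp a' y))); exists phi.
Qed.

Hypotheses (rich1 : rich D1) (rich2 : rich D2).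

Lemma partial_iso_add x x' : same_type a a' x x' -> (D1 x <-> D2 x') ->
  free D1 (x |` dom rho) -> free D2 (x' |` cod rho) ->
  partial_iso D1 D2 ((x, x') |` rho).
Proof.
move=> xx' Dxx' f1 f2; split.
- by rewrite finite_setU; split; [exact: finite_set1|exact: (pi_finite rho_iso)].
- exact: elementary_map_add.
- by move=> y y' [[-> ->]//|]; exact: (pi_mem rho_iso).
- by rewrite /dom image_setU image_set1.
- by rewrite /cod image_setU image_set1.
Qed.

Let K : set rho := [set i | D1 (a i)].

Lemma dom_mem_image : dom rho `&` D1 = a @` K.
Proof.
rewrite dom_image; apply/seteqP; split=> [_ [[i _ <-] D1a]|_ [i Ki <-]].
  by exists i.
by split=> //; exists i.
Qed.

Lemma cod_mem_image : cod rho `&` D2 = a' @` K.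
Proof.
rewrite cod_image; apply/seteqP; split=> [_ [[i _ <-] D2a]|_ [i Ki <-]].
  by exists i => //; apply/(pi_mem rho_iso (rho_val i)).
by split; [exists i|apply/(pi_mem rho_iso (rho_val i))].
Qed.

Lemma free_dcl D A y : free D A -> D y -> dcl S A y -> dcl S (A `&` D) y.
Proof.
move=> fA Dy dy; have := fA set0 _ y Dy; rewrite !setU0; apply=> //.
Qed.

Lemma same_type_sym x x' : same_type a a' x x' -> same_type a' a x' x.
Proof. by move=> xx' phi; rewrite (same_typeE xx'). Qed.

(** Having interior is first-order in the parameters, so the elementary map preserves it. *)
Lemma transported_hasint x : ~ dcl S (dom rho) x -> forall F, finite_set F ->
  F `<=` transported x -> hasint S (fun y => forall X, F X -> X y).
Proof.
move=> ndx F Ff FB; have [phi [Hphi H]] := transported_conj Ff FB.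
have hint : hasint S (fun y => sat S phi (oapp a y)).
  apply: (hasint_of_not_dcl SSR gd) Hphi ndx; apply: dfn1_params => i.
  by rewrite dom_image; exists i.
have : sat S (fneg (fnoint phi)) a'.
  apply: (pi_elementary rho_iso) rho_val _.
  by rewrite sat_neg sat_noint => /noint_hasint.
rewrite sat_neg sat_noint => ni.
have [p [q [pq Hpq]]] : hasint S (fun y => sat S phi (oapp a' y)).
  by apply: contrapT => /not_hasint.
by exists p, q; split=> // y /Hpq; exact: H.
Qed.

(** If [x] is in the closure of the domain, freeness puts it in the closure of the part inside [D1],
    so its image is in [D2], which is closed. Otherwise its type has interior and is realized in
    [D2] by richness. *)
Lemma forth_mem x : D1 x -> exists x', partial_iso D1 D2 ((x, x') |` rho).
Proof.
move=> D1x; suff [x' [xx' D2x']] : exists x', same_type a a' x x' /\ D2 x'.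
  exists x'; apply: partial_iso_add => //.
  - exact: free_add_mem (pi_free_dom rho_iso) D1x.
  - exact: free_add_mem (pi_free_cod rho_iso) D2x'.
have [dx|ndx] := pselect (dcl S (dom rho) x).
  have [x' xx'] := same_type_ex x; exists x'; split=> //.
  apply: (rich_dcl rich2).
  have := free_dcl (pi_free_dom rho_iso) D1x dx.
  rewrite dom_mem_image => /(dcl_same_type xx'); rewrite -cod_mem_image.
  by apply: dcl_mono => z [].
have [|x' [D2x' Hx']] := rich_realize rich2 finite_cod _ (transported_dfn (x := x)) (transported_hasint ndx).
  exists (fimp (fbot _ _) (fbot _ _)); split=> //=.
  by apply/funext => y; apply/propext; split.
exists x'; split=> // phi Hphi.
by apply: (Hx' (fun y => sat S phi (oapp a' y))); exists phi.
Qed.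

(** Freeness of the codomain keeps the image outside [D2]: otherwise [x] would be in the closure of
    the part of the domain inside [D1]. *)
Lemma forth_dcl x : ~ D1 x -> dcl S (dom rho) x ->
  exists x', partial_iso D1 D2 ((x, x') |` rho).
Proof.
move=> nD1x dx; have [x' xx'] := same_type_ex x; exists x'.
have dx' : dcl S (cod rho) x'.
  by move: dx; rewrite dom_image cod_image; exact: dcl_same_type.
apply: partial_iso_add => //.
- split=> // D2x'; exfalso; apply/nD1x/(rich_dcl rich1).
  have := free_dcl (pi_free_cod rho_iso) D2x' dx'.
  rewrite cod_mem_image => /(dcl_same_type (same_type_sym xx')).
  by rewrite -dom_mem_image; apply: dcl_mono => z [].
- exact: free_add_dcl (pi_free_dom rho_iso) dx.
- exact: free_add_dcl (pi_free_cod rho_iso) dx'.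
Qed.

(* The transported type holds on an interval [(x1, x2)]; translating an element outside
   [dcl (cod rho `|` D2)] by an element of the dense set [D2] moves it into that interval. *)
Lemma forth_indep x : ~ dcl S (dom rho `|` D1) x ->
  exists x', partial_iso D1 D2 ((x, x') |` rho).
Proof.
move=> nx; have ndx : ~ dcl S (dom rho) x.
  by move=> dx; apply: nx; apply: dcl_mono dx => z; left.
have [x1 xx1] := same_type_ex x.
have [|X [phi [Hphi ->]]|F Ff FB|x2 Hx2] := satS (A := x1 |` cod rho) (B := [set X |
    exists phi : formula L (option rho), sat S phi (oapp a x) /\
    X = (fun y => x1 <' y /\ forall z, x1 <' z -> z <' y -> sat S phi (oapp a' z))]).
- by rewrite finite_setU; split; [exact: finite_set1|exact: finite_cod].
- have Ax1 : (x1 |` cod rho) x1 by left.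
  have dphi : dfn1 S (x1 |` cod rho) (fun z => sat S phi (oapp a' z)).
    by apply: dfn1_params => i; right; rewrite cod_image; exists i.
  have right_dfn Z : dfn1 S (x1 |` cod rho) Z -> dfn1 S (x1 |` cod rho)
      (fun y => x1 <' y /\ forall z, x1 <' z -> z <' y -> Z z) by move=> dZ; dfn_solve.
  exact: (right_dfn _ dphi).
- have /choice[g Hg] : forall X, exists phi : formula L (option rho), F X ->
      sat S phi (oapp a x) /\
      X = (fun y => x1 <' y /\ forall z, x1 <' z -> z <' y -> sat S phi (oapp a' z)).
    move=> X; have [/FB[phi Hphi]|nFX] := pselect (F X); first by exists phi.
    by exists (fbot _ _).
  have [psi Hpsi] := finite_conj g Ff.
  have psix : sat S psi (oapp a x) by apply/Hpsi => X /Hg[].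
  pose rpsi : formula L (option rho) := fex (fand (flt (tvar L (Some None)) (tvar L None))
    (fall (fimp (flt (tvar L (Some (Some None))) (tvar L None))
      (fimp (flt (tvar L None) (tvar L (Some None))) (frename (omap (Some \o Some)) psi))))).
  have rpsiE b y : sat S rpsi (oapp b y) =
      exists t, y <' t /\ forall z, y <' z -> z <' t -> sat S psi (oapp b z).
    rewrite sat_ex; apply: eq_exists => t; rewrite sat_and sat_lt; congr (_ /\ _).
    rewrite sat_all; apply: eq_forall => z; rewrite !sat_imp !sat_lt sat_rename.
    by rewrite (_ : _ \o _ = oapp b z)//; apply/funext => -[].
  (* As [x] is not in the closure of the domain, [psi] holds on an interval around [x]; so [rpsi]
     belongs to the type of [x] and holds at [x1]. *)
  have : sat S rpsi (oapp a' x1).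
    apply: xx1; rewrite rpsiE.
    have [|p [q [[px xq] Hpq]]] := itv_of_not_dcl SSR gd (A := dom rho) (D := fun y => sat S psi (oapp a y)) _ psix ndx.
      by apply: dfn1_params => i; rewrite dom_image; exists i.
    exists q; split=> // z xz zq; apply: Hpq; split=> //.
    exact: (slt_trans SSR px).
  rewrite rpsiE => -[t [x1t Ht]]; exists t => X FX.
  have [_ ->] := Hg _ FX; split=> // z x1z zt.
  by have /Hpsi := Ht _ x1z zt; exact.
have {}Hx2 phi : sat S phi (oapp a x) -> x1 <' x2 /\
    forall z, x1 <' z -> z <' x2 -> sat S phi (oapp a' z).
  move=> Hphi; apply: (Hx2 (fun y => x1 <' y /\
    forall z, x1 <' z -> z <' y -> sat S phi (oapp a' z))).
  by exists phi.
have [x12 _] : x1 <' x2 /\ forall z, x1 <' z -> z <' x2 ->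
    sat S (fimp (fbot _ _) (fbot _ _)) (oapp a' z) by exact: Hx2.
have [c nc] := rich_not_dcl rich2 finite_cod.
have [u x1u] := ex_diff SSR x1 c; have [w x2w] := ex_diff SSR x2 c.
have uw : u <' w by move: x12; rewrite x1u x2w; og [:: c; u; w]; lra.
have [d [D2d [ud dw]]] := rich_dense rich2 uw.
have x1d : x1 <' c +' d by rewrite x1u; move: ud; og [:: u; d; c]; lra.
have dx2 : c +' d <' x2 by rewrite x2w; move: dw; og [:: d; w; c]; lra.
have nx' : ~ dcl S (cod rho `|` D2) (c +' d).
  move=> dx'; apply: nc.
  apply: (@dfn_dcl_add _ _ _ _ _ _ _ dx').
  have Ad : ((c +' d) |` (cod rho `|` D2)) d by right; right.
  have Ax' : ((c +' d) |` (cod rho `|` D2)) (c +' d) by left.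
  apply: (@dfn_ext _ _ _ _ _ (fun v : unit -> M => v tt +' d = c +' d)).
    by move=> v; split=> [|->//]; og [:: v tt; d; c]; lra.
  by dfn_solve.
exists (c +' d); apply: partial_iso_add.
- by move=> phi /Hx2[_]; apply.
- split=> [D1x|D2x]; [case: nx|case: nx']; by apply: dcl_par; right.
- exact: free_add_indep (pi_free_dom rho_iso) nx.
- exact: free_add_indep (pi_free_cod rho_iso) nx'.
Qed.

End Forth.

Lemma forth_mem_finite D1 D2 rho C : rich D1 -> rich D2 -> partial_iso D1 D2 rho ->
  finite_set C -> C `<=` D1 ->
  exists rho', [/\ rho `<=` rho', partial_iso D1 D2 rho' & C `<=` dom rho'].
Proof.
move=> r1 r2 rho_iso Cf; elim/finite_set_rect_prop : Cf => [_|c {}C _ IH CD].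
  by exists rho; split=> //; exact: sub0set.
have [|rho' [rr' r'iso Cr']] := IH; first by move=> x Cx; apply: CD; right.
have [|c' cc'] := forth_mem r'iso r2 (x := c); first by apply: CD; left.
exists ((c, c') |` rho'); split=> //; first by move=> p /rr'; right.
by move=> x [->|/Cr'[p r'p <-]]; [exists (c, c')|exists p] => //; [left|right].
Qed.

Lemma forth D1 D2 rho x : rich D1 -> rich D2 -> partial_iso D1 D2 rho ->
  exists rho' x', [/\ rho `<=` rho', partial_iso D1 D2 rho' & rho' (x, x')].
Proof.
move=> r1 r2 rho_iso.
have add rho' x' : rho `<=` rho' -> partial_iso D1 D2 ((x, x') |` rho') ->
    exists rho'' x'', [/\ rho `<=` rho'', partial_iso D1 D2 rho'' & rho'' (x, x'')].
  move=> rr' r'iso; exists ((x, x') |` rho'), x'; split=> //; last by left.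
  by move=> p /rr'; right.
have [D1x|nD1x] := pselect (D1 x).
  by have [x'] := forth_mem rho_iso r2 D1x; exact: add.
have [dx|ndx] := pselect (dcl S (dom rho `|` D1) x); last first.
  by have [x'] := forth_indep rho_iso r2 ndx; exact: add.
(* [x] may depend on elements of [D1] outside the domain; finitely many of them are adjoined
   first. *)
have [C [Cf CA dCx]] := dfn_finite dx.
have [||rho' [rr' r'iso Cr']] := forth_mem_finite r1 r2 rho_iso (C := C `&` D1).
- exact: finite_setIl.
- by move=> z [].
have [|x'] := forth_dcl r'iso r1 nD1x; last exact: add.
apply: dcl_mono dCx => z Cz; have [[p rp <-]|D1z] := CA _ Cz.
  by exists p => //; exact: rr'.
exact: Cr'.
Qed.

Lemma elementary_mapE rho V (phi : formula L V) v v' : elementary_map rho ->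
  (forall i, rho (v i, v' i)) -> sat S phi v = sat S phi v'.
Proof.
move=> er vv'; rewrite propeqE; split; first exact: er.
by apply: contraPP => H; apply: (er _ (fneg phi)) vv' H.
Qed.

Definition swap (rho : set (M * M)) : set (M * M) := [set p | rho (p.2, p.1)].

Lemma dom_swap rho : dom (swap rho) = cod rho.
Proof.
by apply/seteqP; split=> _ [[x y] rxy <-]; exists (y, x).
Qed.

Lemma cod_swap rho : cod (swap rho) = dom rho.
Proof.
by apply/seteqP; split=> _ [[x y] rxy <-]; exists (y, x).
Qed.

Lemma partial_iso_swap D1 D2 rho :
  partial_iso D1 D2 rho -> partial_iso D2 D1 (swap rho).
Proof.
move=> [rf re rm rd rc]; split.
- apply: finite_preimage rf => p q _ _ [].
  by case: p q => ? ? [? ?] /= -> ->.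
- by move=> V phi v v' vv'; rewrite (elementary_mapE (v := v') (v' := v) phi re vv').
- by move=> x x' /rm; tauto.
- by rewrite dom_swap.
- by rewrite cod_swap.
Qed.

Lemma back D1 D2 rho x' : rich D1 -> rich D2 -> partial_iso D1 D2 rho ->
  exists rho' x, [/\ rho `<=` rho', partial_iso D1 D2 rho' & rho' (x, x')].
Proof.
move=> r1 r2 /partial_iso_swap /(forth x' r2 r1) [rho' [x [rr' r'iso r'x]]].
exists (swap rho'), x; split=> //; last exact: partial_iso_swap.
by move=> [y y'] ryy'; exact: rr'.
Qed.

End BackAndForth.

(** * Construction of the second predicate *)

Fixpoint tunlift (L : language) (V : Type) (t : term (pair_lang L) V) : term L V :=
  match t with
  | tvar x => tvar L x
  | tapp f ts =>
    match f return ('I_(@farity (pair_lang L) f) -> term (pair_lang L) V) -> _ with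
    | inl f => fun ts => @tapp L V f (fun i => tunlift (ts i))
    | inr f => fun=> match f with end
    end ts
  end.

Lemma eval_unlift (L : language) M (S : structure L M) P V (t : term (pair_lang L) V) v :
  eval (expand_pred S P) v t = eval S v (tunlift t).
Proof.
elim: t => [//|[f|[]] ts IH] /=; congr finterp.
by apply/funext => i; rewrite IH.
Qed.

Lemma isomorphism_eval (L : language) M N (S : structure L M) (S' : structure L N) f
    V (t : term L V) v :
  is_isomorphism S S' f -> f (eval S v t) = eval S' (f \o v) t.
Proof.
move=> [_ fS _]; elim: t => [//|g ts IH] /=; rewrite fS; congr finterp.
by apply/funext => i /=; rewrite IH.
Qed.

Lemma isomorphism_sat (L : language) M N (S : structure L M) (S' : structure L N) f
    V (phi : formula L V) v :
  is_isomorphism S S' f -> sat S phi v = sat S' phi (f \o v).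
Proof.
move=> isof; have [[g fK gK] _ fR] := isof.
elim: phi v => //= {V} [V s t|V r ts|V phi IH1 psi IH2|V phi IH] v.
- rewrite -!(isomorphism_eval _ _ isof) propeqE.
  by split=> [->//|]; exact: (can_inj fK).
- rewrite propeqE (fR r) (_ : f \o _ = (fun i => eval S' (f \o v) (ts i)))//.
  by apply/funext => i /=; rewrite (isomorphism_eval _ _ isof).
- by rewrite IH1 IH2.
- have fE x : f \o oapp v x = oapp (f \o v) (f x) by apply/funext => -[].
  rewrite propeqE; split=> H x; last by rewrite IH fE.
  by have := H (g x); rewrite IH fE gK.
Qed.

Section Main.
Variables (R : realType) (L' : language) (E : structure L' R).
Let L := lang_sum ogroup_lang L'.
Let SR : structure L R := struct_sum (ogroup_struct R) E.

(** * Elementary equivalence of rich predicates *)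

Section Equivalence.
Variables (M : Type) (S : structure L M).
Hypothesis SSR : theory_of S = theory_of SR.
Hypothesis gd : forall D : M -> Prop, dfn1 S setT D -> noint S D -> finite_set D.
Hypothesis satS : forall A (B : set (set M)), finite_set A ->
  (forall D, B D -> dfn1 S A D) ->
  (forall F, finite_set F -> F `<=` B -> exists x, forall D, F D -> D x) ->
  exists x, forall D, B D -> D x.

Lemma partial_iso_sat D1 D2 : rich S D1 -> rich S D2 ->
  forall V (phi : formula (pair_lang L) V) rho v v', partial_iso S D1 D2 rho ->
    (forall i, rho (v i, v' i)) ->
    sat (expand_pred S D1) phi v <-> sat (expand_pred S D2) phi v'.
Proof.
move=> r1 r2 V phi; elim: phi => {V} [V|V s t|V r ts|V phi IH1 psi IH2|V phi IH] rho v v' rho_iso vv'.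
- by [].
- rewrite !sat_eq !eval_unlift -!sat_eq.
  by rewrite (elementary_mapE (feq (tunlift s) (tunlift t)) (pi_elementary rho_iso) vv').
- case: r ts => [r|[]] ts /=.
    have tsE D w : (fun i => eval (expand_pred S D) w (ts i)) =
        (fun i => eval S w (tunlift (ts i))) by apply/funext => i; rewrite eval_unlift.
    rewrite !tsE.
    have := elementary_mapE (@Defs.frel L V r (fun i => tunlift (ts i))) (pi_elementary rho_iso) vv'.
    by move=> /= ->.
  rewrite !eval_unlift; set t := tunlift _.
  (* [pi_mem] concerns pairs in the map, so the value of the term at [v] is added first; by
     elementarity its partner is the value at [v']. *)
  have [rho' [x' [rr' r'iso r'x]]] := forth SSR gd satS (eval S v t) r1 r2 rho_iso.
  have := elementary_mapE (feq (tvar L None) (trename some t)) (pi_elementary r'iso)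
    (v := oapp v (eval S v t)) (v' := oapp v' x').
  rewrite !sat_eq !eval_rename /=.
  have -> : oapp v (eval S v t) \o some = v by [].
  have -> : oapp v' x' \o some = v' by [].
  move=> H; have <- : x' = eval S v' t.
    by rewrite -H // => -[i|]; [exact: rr' (vv' i)|exact: r'x].
  exact: (pi_mem r'iso).
- by rewrite !sat_imp (IH1 _ _ _ rho_iso vv') (IH2 _ _ _ rho_iso vv').
- rewrite !sat_all; split=> H x.
  + have [rho' [y [rr' r'iso r'x]]] := back SSR gd satS x r1 r2 rho_iso.
    apply/(IH rho' (oapp v y) _ r'iso); last exact: H.
    by case=> [i|]; [exact: rr' (vv' i)|exact: r'x].
  + have [rho' [y [rr' r'iso r'x]]] := forth SSR gd satS x r1 r2 rho_iso.
    apply/(IH rho' _ (oapp v' y) r'iso); last exact: H.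
    by case=> [i|]; [exact: rr' (vv' i)|exact: r'x].
Qed.

Lemma rich_equivalent D1 D2 : rich S D1 -> rich S D2 ->
  elementarily_equivalent (expand_pred S D1) (expand_pred S D2).
Proof.
move=> r1 r2; have iso0 : partial_iso S D1 D2 set0.
  split=> //.
  - move=> V phi v v' vv'; rewrite (_ : v = v')//.
    by apply/funext => i; case: (vv' i).
  - by rewrite /dom image_set0; exact: free0.
  - by rewrite /cod image_set0; exact: free0.
apply/seteqP; split=> phi; rewrite /theory_of /= => H.
  by apply/(partial_iso_sat r1 r2 phi iso0 (v := of_void M)).
by apply/(partial_iso_sat r1 r2 phi iso0 (v' := of_void M)).
Qed.

End Equivalence.

(** * A closed predicate of countable codimension *)

Section Construction.
Variables (M : Type) (S : structure L M) (P : set M).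
Hypothesis SSR : theory_of S = theory_of SR.
Hypothesis gd : forall D : M -> Prop, dfn1 S setT D -> noint S D -> finite_set D.
Hypothesis Pind : forall A, countable A -> exists x, ~ dcl S (A `|` P) x.

Lemma independent_sequence : exists (c : nat -> M) (C : nat -> set M),
  [/\ forall n, finite_set (C n), forall n, C n.+1 = c n |` C n,
      countable (\bigcup_n C n) & forall n, ~ dcl S (P `|` C n) (c n)].
Proof.
have /choice[next Hnext] : forall A : set M, exists x, countable A -> ~ dcl S (A `|` P) x.
  move=> A; have [cA|ncA] := pselect (countable A : Prop).
    by have [x Hx] := Pind cA; exists x.
  by have [x _] := Pind (countable0 M); exists x.
(* [C n] consists of the first [n] terms of the sequence. *)
pose C := fix C n := if n is m.+1 then next (C m) |` C m else set0.
have Cf n : finite_set (C n).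
  elim: n => [|n IH]; first exact: finite_set0.
  by rewrite /= finite_setU; split; [exact: finite_set1|].
exists (next \o C), C; split=> //.
  by apply: bigcup_countable => // n _; exact: finite_set_countable.
by move=> n; rewrite setUC; apply: Hnext; exact: finite_set_countable.
Qed.

Lemma maximal_extension (c : nat -> M) (C : nat -> set M) :
  (forall n, C n.+1 = c n |` C n) -> (forall n, ~ dcl S (P `|` C n) (c n)) ->
  exists D : set M, [/\ P `<=` D, forall x, dcl S D x -> D x,
    forall n, ~ dcl S (D `|` C n) (c n) & forall a, dcl S (D `|` \bigcup_n C n) a].
Proof.
move=> CS Pc.
have [|D0 [D0c D0max]] := @Zorn_bigcup _ (fun D => forall n, ~ dcl S ((P `|` D) `|` C n) (c n)).
  move=> F Fc Ftot n /dfn_finite[B [Bf BD dB]].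
  have [|BP|[X [FX BX]]] := @finite_sub_chain _ (P `|` C n) B F Ftot Bf.
  - by move=> x /BD[[|]|]; [left; left|right|left; right].
  - by apply: (Pc n); apply: dcl_mono dB.
  - apply: (Fc _ FX n); apply: dcl_mono dB => x /BX[[]|].
    + by left; left.
    + by right.
    + by left; right.
pose D := P `|` D0.
have maxD a : (forall n, ~ dcl S ((a |` D) `|` C n) (c n)) -> D a.
  move=> H; apply: contrapT => nDa; apply: (D0max (a |` D0)).
    split=> [|H']; first exact: subsetUr.
    by apply: nDa; right; apply: H'; left.
  by move=> n; rewrite setUCA; exact: H.
have clD x : dcl S D x -> D x.
  move=> dx; apply: maxD => n dn; apply: (D0c n).
  apply: dcl_trans dn => z [[->|Dz]|Cz].
  - by apply: dcl_mono dx => w; left.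
  - by apply: dcl_par; left.
  - by apply: dcl_par; right.
exists D; split=> // [x|a]; first by left.
have [Da|nDa] := pselect (D a); first by apply: dcl_par; left.
(* By maximality, adding [a] breaks independence at some [n]; exchange then puts [a] in the closure
   of [D] and [C n.+1]. *)
have [n dn] : exists n, dcl S ((a |` D) `|` C n) (c n).
  by apply: contrapT => H; apply/nDa/maxD => n dn; apply: H; exists n.
rewrite -setUA in dn.
have := dcl_exchange SSR gd dn (D0c n); apply: dcl_mono => x [->|[Dx|Cx]].
- by right; exists n.+1 => //; rewrite CS; left.
- by left.
- by right; exists n.
Qed.

(** A finite [A] lies in the closure of [D] and some [C n], and that closure omits [c n]. *)
Lemma rich_of_independent D (c : nat -> M) (C : nat -> set M) :
  (forall n, finite_set (C n)) -> (forall n, C n.+1 = c n |` C n) ->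
  (forall n, ~ dcl S (D `|` C n) (c n)) -> (forall a, dcl S (D `|` \bigcup_n C n) a) ->
  forall A, finite_set A -> exists x, ~ dcl S (A `|` D) x.
Proof.
move=> Cf CS Dc Dgen A Af.
have Cmono m n : m <= n -> C m `<=` C n.
  elim: n => [|n IH]; first by rewrite leqn0 => /eqP ->.
  rewrite leq_eqVlt ltnS => /predU1P[->//|/IH mn].
  by rewrite CS => x /mn; right.
have Ctot : total_on [set C n | n in [set: nat]] subset.
  move=> _ _ [m _ <-] [n _ <-].
  by have [mn|/ltnW nm] := leqP m n; [left|right]; exact: Cmono.
have [n An] : exists n, forall a, A a -> dcl S (D `|` C n) a.
  elim/finite_set_rect_prop : Af => [|a {}A _ [m Hm]]; first by exists 0.
  have [B [Bf BC dB]] := dfn_finite (Dgen a).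
  have {BC dB} [n dn] : exists n, dcl S (D `|` C n) a.
    have [|BD|[_ [[n _ <-] BX]]] := @finite_sub_chain _ D B _ Ctot Bf.
    - by move=> x /BC[|[n _ Cx]]; [left|right; exists (C n) => //; exists n].
    - by exists 0; apply: dcl_mono dB => x /BD; left.
    - by exists n; exact: dcl_mono dB.
  exists (maxn m n) => b [->|/Hm].
    by apply: dcl_mono dn; apply: setUS; apply: Cmono; exact: leq_maxr.
  by apply: dcl_mono; apply: setUS; apply: Cmono; exact: leq_maxl.
exists (c n) => dn; apply: (Dc n); apply: dcl_trans dn => z [/An//|Dz].
by apply: dcl_par; left.
Qed.

(** The formula defining [f a] over [D] and [A] is pulled back along [f], which carries [P] onto
    [D]. *)
Lemma isomorphic_generators D A f :
  is_isomorphism (expand_pred S P) (expand_pred S D) f ->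
  (forall a, dcl S (D `|` A) a) -> forall a, dcl S ((f @^-1` A) `|` P) a.
Proof.
move=> isof Dgen a; have [phi Hphi] := Dgen (f a).
have [[g fK gK] _ fR] := isof.
have PD x : P x <-> D (f x) by exact: (fR (inr tt) (fun=> x)).
have gP (b : D `|` A) : ((f @^-1` A) `|` P) (g (\val b)).
  have [Db|Ab] := set_mem (valP b); [right; rewrite PD|left; rewrite /preimage /=];
  by rewrite gK.
apply: dfn_ext (dfn1_params (p := fun b => g (\val b)) S (frename (fun z =>
  match z with inl _ => None | inr b => Some b end) phi) gP) => v.
rewrite sat_rename -(sat_lift S P) (isomorphism_sat _ _ isof) sat_lift.
rewrite (_ : _ \o _ = param_env (A := D `|` A) (fun=> f (v tt))).
  by rewrite -(Hphi (fun=> f (v tt))); split=> [/(can_inj fK)|->].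
by apply/funext => -[//|b] /=; rewrite gK.
Qed.

End Construction.
End Main.

Theorem proposition5p11
    (R : realType) (L' : language) (E : structure L' R)
    (Lam : Type) (M : Type)
    (S : structure (lang_sum ogroup_lang L') M) (P : set M) :
  o_minimal (struct_sum (ogroup_struct R) E) ->
  strongly_inaccessible Lam ->
  lang_card_lt (lang_sum ogroup_lang L') Lam ->
  monster_model Lam
    (lovely_theory (theory_of (struct_sum (ogroup_struct R) E)))
    (expand_pred S P) ->
  o_class S P <> e_class S P.
Proof.
move=> omin inacc _ [mod satPS ML] oe.
have small A : countable A -> card_lt A [set: M] := countable_small inacc ML.
have SSR := monster_theory mod.
have gd := monster_finite omin mod satPS small.
have satS := saturated_reduct satPS small.
have Pdcl := monster_dcl mod.
have Pind := monster_not_dcl mod satPS small.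
have richP : rich S P.
  split; [exact: Pdcl|exact: monster_dense mod|exact: monster_realize mod satPS small|].
  by move=> A /finite_set_countable; exact: Pind.
have [c [C [Cf CS Cc Pc]]] := independent_sequence Pind.
have [D [PD Ddcl Dc Dgen]] := maximal_extension SSR gd CS Pc.
have richD : rich S D.
  split=> //.
  - move=> x y /(monster_dense mod)[p [Pp pxy]]; exists p; split=> //; exact: PD.
  - move=> A B Af BT dB HB.
    have [p [Pp Hp]] := monster_realize mod satPS small Af BT dB HB.
    by exists p; split=> //; exact: PD.
  - exact: rich_of_independent Cf CS Dc Dgen.
have : e_class S P D := rich_equivalent SSR gd satS richP richD.
rewrite -oe => -[f isof].
(* The preimage of the sequence would be a countable set generating [M] over [P], against [Pind]. *)
have fCc : countable (f @^-1` (\bigcup_n C n)).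
  have [[g fK gK] _ _] := isof.
  rewrite (_ : f @^-1` _ = g @` (\bigcup_n C n)).
    by apply: sub_countable Cc; exact: card_image_le.
  apply/seteqP; split=> [x Cfx|_ [y Cy <-]]; first by exists (f x).
  by rewrite /preimage /= gK.
have [x nx] := Pind _ fCc.
by apply: nx; exact: isomorphic_generators isof Dgen x.
Qed.
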